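(* Let $S$ be an infinite subset of $\mathbb F_q^1[X]$ that has growth density with exponent $\alpha\ge 1$. For any $U\subset S$ with $\overline{d}_q(U|S)>0$, there exists a subset $E_{S,U}$ of $\{x\in E\colon \{A_n(x)\colon n\in\mathbb N\}\subset S\}$ such that \[\dim_{\rm H}E_{S,U}=\dim_{\rm H}\{x\in E\colon \{A_n(x)\colon n\in\mathbb N\}\subset S\}=\frac{1}{2\alpha},\] \[\overline{d}_q\left(\bigcup_{n\in\mathbb N}\bigcap_{x\in E_{S,U}}\{A_n(x)\}\cap U\,\middle|\,S\right)=\overline{d}_q(U|S),\] and \[\overline{d}\left(\bigcup_{n\in\mathbb N}\bigcap_{x\in E_{S,U}}\{\deg A_n(x)\}\cap \deg(U)\,\middle|\,\deg(S)\right)=\overline{d}(\deg(U)|\deg(S)).\] In particular, the Hausdorff dimension of the set of all $x\in E$ satisfying the three conditions (i) $\{A_n(x)\colon n\in\mathbb N\}\subset S$, (ii) $\overline{d}_q(\{A_n(x)\colon n\in\mathbb N\}\cap U\,|\,S)=\overline{d}_q(U|S)$, (iii) $\overline{d}(\{\deg A_n(x)\colon n\in\mathbb N\}\cap \deg(U)\,|\,\deg(S))=\overline{d}(\deg(U)|\deg(S))$ equals $\dim_{\rm H}\{x\in E\colon \{A_n(x)\colon n\in\mathbb N\}\subset S\}$.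
   Context: $\mathbb F_q$ is a finite field with $q$ elements, and $\mathbb F_q((X^{-1}))$ is the field of formal Laurent series $x=\sum_{i=n_0}^\infty c_iX^{-i}$ ($n_0\in\mathbb Z$, $c_i\in\mathbb F_q$). For $x\ne 0$, $\deg x=-\inf\{n\in\mathbb Z\colon c_n\ne 0\}$ and $\|x\|_q=q^{\deg x}$; $\|0\|_q=0$. $\mathbb F_q(X)$ (rational functions) is regarded as a subfield of $\mathbb F_q((X^{-1}))$ via expansion at infinity. The integral part is $[x]=\sum_{i=n_0}^0c_iX^{-i}\in\mathbb F_q[X]$. Let $\Delta=\{x\in\mathbb F_q((X^{-1}))\colon\|x\|_q<1\}$, with metric $\|x-y\|_q$; $\dim_{\rm H}$ is the Hausdorff dimension on $\Delta$ for this metric. $\mathbb N=\{1,2,\dots\}$ and $\mathbb F_q^1[X]=\{A\in\mathbb F_q[X]\colon\deg A\ge 1\}$. Define $T\colon\Delta\to\Delta$ by $T(x)=1/x-[1/x]$ for $x\neq0$ and $T(0)=0$. For $n\ge1$ the $n$th digit of $x\in\Delta$ is $A_n(x)=[1/T^{n-1}(x)]\in\mathbb F_q^1[X]$, defined if $T^{n-1}(x)\ne0$. Every $x\in\Delta\setminus\mathbb F_q(X)$ has all digits defined and has the unique infinite continued fraction expansion $x=1/(A_1(x)+1/(A_2(x)+\cdots))$. $E=\{x\in\Delta\setminus\mathbb F_q(X)\colon A_m(x)\ne A_n(x)\text{ for all }m\ne n\}$. For $S\subset\mathbb F_q^1[X]$ and $N\in\mathbb N$, $Q_N(S)=\{A\in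 S\colon\deg A\le N\}$ and $\deg(S)=\{\deg A\colon A\in S\}\subset\mathbb N$. For $U\subset S\subset\mathbb F_q^1[X]$, $\overline d_q(U|S)=\limsup_{N\to\infty}\#Q_N(U)/\#Q_N(S)$. For $B\subset G\subset\mathbb N$, $\overline d(B|G)=\limsup_{N\to\infty}\#(B\cap[1,N])/\#(G\cap[1,N])$. $S\subset\mathbb F_q^1[X]$ has growth density with exponent $\alpha$ if $\alpha\ge1$ and there exist constants $\gamma_1,\gamma_2>0$ and $\beta\ge0$ such that $\gamma_1 q^{N/\alpha}/N^\beta\le\#Q_N(S)\le\gamma_2q^{N/\alpha}/N^\beta$ for all sufficiently large $N$. The set $\bigcap_{x\in E_{S,U}}\{A_n(x)\}$ is $\{A\}$ if $A_n(x)=A$ for every $x\in E_{S,U}$, and is empty if $A_n$ is not constant on $E_{S,U}$; similarly for $\deg A_n(x)$. *)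

(* Defs.v *)
From HB Require Import structures.
From mathcomp Require Import all_boot all_order all_algebra finmap.
From mathcomp Require Import all_classical all_reals all_analysis.
From mathcomp Require Import zify.

Set Implicit Arguments.
Unset Strict Implicit.
Unset Printing Implicit Defensive.

Import Order.TTheory GRing.Theory Num.Theory.
Local Open Scope classical_set_scope.
Local Open Scope ring_scope.

(** * Formal Laurent series in X^-1

    [lcoef x i] is the coefficient of X^(-i) in x. *)
Record laurent (F : fieldType) := Laurent {
  lcoef :> int -> F;
  lcoefP : exists n0 : int, forall i, i < n0 -> lcoef i = 0 }.

HB.instance Definition _ (F : fieldType) := gen_eqMixin (laurent F).
HB.instance Definition _ (F : fieldType) := gen_choiceMixin (laurent F).

Section LaurentField.
Variable F : fieldType.
Implicit Types x y z : laurent F.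

Definition supp_ge x (a : int) := forall i, i < a -> x i = 0.

Lemma laurent_eqP x y : (forall i, x i = y i) -> x = y.
Proof.
case: x y => [f fP] [g gP] /= /funext fg; subst g.
by congr Laurent; exact: Prop_irrelevance.
Qed.

Fact zero_subproof : exists n0 : int, forall i : int, i < n0 -> 0 = 0 :> F.
Proof. by exists 0. Qed.
Definition lzero := Laurent zero_subproof.

Fact add_subproof x y : exists n0 : int, forall i, i < n0 -> x i + y i = 0.
Proof.
have [a xa] := lcoefP x; have [b yb] := lcoefP y.
by exists (Num.min a b) => i; rewrite lt_min => /andP[/xa -> /yb ->]; rewrite addr0.
Qed.
Definition ladd x y := Laurent (add_subproof x y).

Fact opp_subproof x : exists n0 : int, forall i, i < n0 -> - x i = 0.
Proof. by have [a xa] := lcoefP x; exists a => i /xa ->; rewrite oppr0. Qed.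
Definition lopp x := Laurent (opp_subproof x).

Fact laddA : associative ladd.
Proof. by move=> x y z; apply: laurent_eqP => i /=; rewrite addrA. Qed.
Fact laddC : commutative ladd.
Proof. by move=> x y; apply: laurent_eqP => i /=; rewrite addrC. Qed.
Fact ladd0 : left_id lzero ladd.
Proof. by move=> x; apply: laurent_eqP => i /=; rewrite add0r. Qed.
Fact laddN : left_inverse lzero lopp ladd.
Proof. by move=> x; apply: laurent_eqP => i /=; rewrite addNr. Qed.

HB.instance Definition _ :=
  GRing.isZmodule.Build (laurent F) laddA laddC ladd0 laddN.

(* The sum has finite support since both factors vanish at all small indices. *)
Definition mul_coef x y (n : int) : F := \sum_(i \in [set: int]) x i * y (n - i).

Lemma mul_coefE x y a b (n : nat) : supp_ge x a -> supp_ge y b ->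
  mul_coef x y (a + b + n%:Z) =
  \sum_(i < n.+1) x (a + i%:Z) * y (b + (n - i)%N%:Z).
Proof.
move=> xa yb; rewrite /mul_coef.
pose h (k : nat) : int := a + k%:Z.
have hinj : set_inj `I_n.+1 h by move=> i j _ _ /addrI [].
rewrite -(fsbig_widen (h @` `I_n.+1)) //; last first.
  move=> i /= [_ hi]; have [/xa ->|ai] := ltP i a; first by rewrite mul0r.
  have [/yb ->|] := ltP (a + b + n%:Z - i) b; first by rewrite mulr0.
  move=> bi; exfalso; apply: hi; exists `|i - a|%N => /=.
    by lia.
  by rewrite /h; lia.
rewrite (fsbig_image _ h _ hinj) -fsbig_ord.
apply: eq_bigr => i _; rewrite /h; congr (_ * y _).
by have := ltn_ord i; lia.
Qed.

Lemma mul_coef0 x y a b (n : int) : supp_ge x a -> supp_ge y b ->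
  n < a + b -> mul_coef x y n = 0.
Proof.
move=> xa yb nab; rewrite /mul_coef fsbig1 // => i _.
have [/xa ->|ai] := ltP i a; first by rewrite mul0r.
by rewrite yb ?mulr0 //; lia.
Qed.

Fact mul_subproof x y : exists n0 : int, forall i, i < n0 -> mul_coef x y i = 0.
Proof.
have [a xa] := lcoefP x; have [b yb] := lcoefP y.
by exists (a + b) => i; exact: mul_coef0.
Qed.
Definition lmul x y := Laurent (mul_subproof x y).

Fact one_subproof : exists n0 : int, forall i : int, i < n0 -> (i == 0)%:R = 0 :> F.
Proof. by exists 0 => i; case: eqP => // ->. Qed.
Definition lone := Laurent one_subproof.

Definition ltrunc x a n : {poly F} := \poly_(i < n) x (a + i%:Z).

Lemma mul_trunc x y a b (n m : nat) : supp_ge x a -> supp_ge y b -> (n < m)%N ->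
  lmul x y (a + b + n%:Z) = (ltrunc x a m * ltrunc y b m)`_n.
Proof.
move=> xa yb nm; rewrite /= (mul_coefE _ xa yb) coefM; apply: eq_bigr => i _.
rewrite !coef_poly; have := ltn_ord i => ni.
by rewrite !ifT //; lia.
Qed.

Lemma supp_mul x y a b : supp_ge x a -> supp_ge y b -> supp_ge (lmul x y) (a + b).
Proof. by move=> xa yb i; exact: mul_coef0. Qed.

Lemma supp_eq x y a : supp_ge x a -> supp_ge y a ->
  (forall n : nat, x (a + n%:Z) = y (a + n%:Z)) -> x = y.
Proof.
move=> xa ya xy; apply: laurent_eqP => i.
have [ia|ai] := ltP i a; first by rewrite xa ?ya.
by have := xy `|i - a|%N; have -> : a + `|i - a|%N%:Z = i by lia.
Qed.

Fact lmulC : commutative lmul.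
Proof.
move=> x y; have [a xa] := lcoefP x; have [b yb] := lcoefP y.
apply: (@supp_eq _ _ (a + b)); first exact: supp_mul.
  by rewrite addrC; exact: supp_mul.
move=> n; rewrite (mul_trunc xa yb (ltnSn n)) [a + b]addrC.
by rewrite (mul_trunc yb xa (ltnSn n)) mulrC.
Qed.

Lemma coefM_agree (p p' q : {poly F}) n :
  (forall i, (i <= n)%N -> p`_i = p'`_i) -> (p * q)`_n = (p' * q)`_n.
Proof.
by move=> pp'; rewrite !coefM; apply: eq_bigr => i _; rewrite pp' // -ltnS.
Qed.

Fact lmulA : associative lmul.
Proof.
move=> x y z.
have [a xa] := lcoefP x; have [b yb] := lcoefP y; have [c zc] := lcoefP z.
have xy := supp_mul xa yb; have yz := supp_mul yb zc.
apply: (@supp_eq _ _ (a + b + c)).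
- by rewrite -addrA; exact: supp_mul.
- exact: supp_mul.
move=> n; rewrite (mul_trunc xy zc (ltnSn n)) -(addrA a b c) (mul_trunc xa yz (ltnSn n)).
have -> : (ltrunc (lmul x y) (a + b) n.+1 * ltrunc z c n.+1)`_n =
    (ltrunc x a n.+1 * ltrunc y b n.+1 * ltrunc z c n.+1)`_n.
  apply: coefM_agree => i ni.
  by rewrite coef_poly ltnS ni (mul_trunc xa yb (_ : i < n.+1)%N).
rewrite -mulrA ![(ltrunc x _ _ * _)]mulrC; apply: coefM_agree => i ni.
by rewrite coef_poly ltnS ni (mul_trunc yb zc (_ : i < n.+1)%N).
Qed.

Fact lmul1 : left_id lone lmul.
Proof.
move=> x; have [b xb] := lcoefP x.
have s1 : supp_ge lone 0 by move=> i /=; case: eqP => // ->.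
apply: (@supp_eq _ _ (0 + b)); rewrite ?add0r //.
  by rewrite -[b]add0r; exact: supp_mul.
move=> n; rewrite -{1}[b]add0r /= (mul_coefE _ s1 xb) big_ord_recl /=.
rewrite big1 ?addr0; first by rewrite mul1r subn0.
by move=> i _; rewrite mul0r.
Qed.

Fact lmulDl : left_distributive lmul ladd.
Proof.
move=> x y z; have [a0 xa0] := lcoefP x; have [b0 yb0] := lcoefP y.
have [c zc] := lcoefP z; pose a := Num.min a0 b0.
have xa : supp_ge x a by move=> i; rewrite lt_min => /andP[/xa0].
have ya : supp_ge y a by move=> i; rewrite lt_min => /andP[_ /yb0].
have xya : supp_ge (ladd x y) a by move=> i ia /=; rewrite xa ?ya ?addr0.
apply: (@supp_eq _ _ (a + c)); first exact: supp_mul.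
  by move=> i ia /=; rewrite !(@mul_coef0 _ _ a c) ?addr0.
move=> n /=; rewrite !(@mul_coefE _ _ a c) // -big_split /=.
by apply: eq_bigr => i _; rewrite mulrDl.
Qed.

Fact lone_neq0 : lone != lzero.
Proof. by apply/eqP => /(congr1 (fun x => lcoef x 0)) /= /eqP; rewrite oner_eq0. Qed.

HB.instance Definition _ := GRing.Zmodule_isComNzRing.Build (laurent F)
  lmulA lmulC lmul1 lmulDl lone_neq0.

Definition linv x : laurent F := xget 0 [set y | y * x = 1].

Lemma laurent_lead x : x != 0 ->
  exists a : int, x a != 0 /\ supp_ge x a.
Proof.
move=> x0; have [b xb] := lcoefP x.
have ex : exists n : nat, x (b + n%:Z) != 0.
  apply: contrapT => xn; move/eqP: x0; apply.
  apply: (@supp_eq _ _ b) => // n; apply/eqP; apply: contra_notT xn => H.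
  by exists n.
exists (b + (ex_minn ex)%:Z); case: ex_minnP => n xn nmin; split => // i ib.
have [/xb //|bi] := ltP i b.
have ibE : i = b + `|i - b|%N%:Z by lia.
apply/eqP/negPn/negP => xi; have /nmin : x (b + `|i - b|%N%:Z) != 0 by rewrite -ibE.
by lia.
Qed.

(* Successive coefficients of the inverse of the power series with
   coefficients [f]. *)
Fixpoint inv_seq (f : nat -> F) (n : nat) : seq F :=
  if n is m.+1 then
    let s := inv_seq f m in
    rcons s ((f 0%N)^-1 * ((m == 0%N)%:R - \sum_(i < m) f (m - i)%N * s`_i))
  else [::].

Lemma size_inv_seq f n : size (inv_seq f n) = n.
Proof. by elim: n => //= n IH; rewrite size_rcons IH. Qed.

Lemma nth_inv_seq f n i : (i < n)%N -> (inv_seq f n)`_i = (inv_seq f i.+1)`_i.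
Proof.
elim: n => // n IH; rewrite ltnS leq_eqVlt => /orP[/eqP-> //|ni].
by rewrite [inv_seq f n.+1]/= nth_rcons size_inv_seq ni IH.
Qed.

Lemma inv_seqP (f : nat -> F) (n : nat) : f 0%N != 0 ->
  \sum_(i < n.+1) (inv_seq f i.+1)`_i * f (n - i)%N = (n == 0%N)%:R.
Proof.
move=> f0; rewrite big_ord_recr /= nth_rcons size_inv_seq ltnn eqxx subnn.
rewrite mulrAC mulVf // mul1r (eq_bigr (fun i : 'I_n => f (n - i)%N * (inv_seq f n)`_i)).
  by rewrite addrC subrK.
by move=> i _; rewrite mulrC (nth_inv_seq _ (ltn_ord i)).
Qed.

Lemma linv_ex x : x != 0 -> exists y, y * x = 1.
Proof.
move=> /laurent_lead[a [xa0 xa]].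
pose f (n : nat) := x (a + n%:Z).
pose g (i : int) : F :=
  if i + a < 0 then 0 else (inv_seq f `|i + a|.+1)`_`|i + a|.
have gP : exists n0 : int, forall i, i < n0 -> g i = 0.
  by exists (- a) => i ia; rewrite /g ifT //; lia.
have sg : supp_ge (Laurent gP) (- a) by move=> i ia /=; rewrite /g ifT //; lia.
exists (Laurent gP); apply: (@supp_eq _ _ (- a + a)).
- exact: supp_mul.
- by move=> i; rewrite addNr => i0 /=; case: eqP i0 => // ->.
move=> n; rewrite [LHS](mul_coefE _ sg xa) addNr add0r /=.
have f0 : f 0%N != 0 by rewrite /f addr0.
rewrite -[RHS](inv_seqP n f0); apply: eq_bigr => i _; congr (_ * _).
rewrite /g ifF; last by lia.
by have -> : `|(- a + i%:Z + a)%R|%N = i by lia.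
Qed.

Fact lmulV x : x != 0 -> linv x * x = 1.
Proof. by move=> /linv_ex [y yx]; exact: (@xgetI _ 0 [set y | y * x = 1] y). Qed.

Fact linv0 : linv 0 = 0.
Proof.
by rewrite /linv xgetPN // => y /=; rewrite mulr0 => /esym/eqP; rewrite oner_eq0.
Qed.

HB.instance Definition _ := GRing.ComNzRing_isField.Build (laurent F) lmulV linv0.

(* deg x = - inf {n | c_n <> 0}; junk value 0 at x = 0. *)
Definition ldeg x : int := - xget 0 [set n : int | x n != 0 /\ supp_ge x n].

Lemma ldegP x : x != 0 -> x (- ldeg x) != 0 /\ supp_ge x (- ldeg x).
Proof.
move=> /laurent_lead[a aP]; rewrite /ldeg opprK.
exact: (@xgetI _ 0 [set n : int | x n != 0 /\ supp_ge x n] a).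
Qed.

(* [x]: the terms with k > deg x vanish, so the bound is harmless. *)
Definition intpart x : {poly F} := \poly_(k < `|ldeg x|.+1) x (- k%:Z).

Fact laurent_of_poly_subproof (p : {poly F}) : exists n0 : int, forall i : int,
  i < n0 -> (if i <= 0 then p`_`|i| else 0) = 0.
Proof.
exists (- (size p)%:Z) => i ip; case: ifP => // i0; rewrite nth_default //.
by move: (size p) ip => m; lia.
Qed.
Definition laurent_of_poly (p : {poly F}) : laurent F :=
  Laurent (laurent_of_poly_subproof p).

Definition rational_laurent : set (laurent F) :=
  [set x | exists P Q : {poly F}, Q != 0 /\
     x = laurent_of_poly P / laurent_of_poly Q].

End LaurentField.

Definition lnorm (R : realType) (F : finFieldType) (x : laurent F) : R :=
  if x == 0 then 0 else #|F|%:R ^ ldeg x.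

Definition ldist (R : realType) (F : finFieldType) (x y : laurent F) : R :=
  lnorm R (x - y).

Definition Delta (R : realType) (F : finFieldType) : set (laurent F) :=
  [set x | lnorm R x < 1].

(** * Hausdorff dimension for a distance function

    The dimension of A only depends on the distance restricted to A, so the
    ambient space (here all Laurent series rather than Delta) is immaterial. *)

Section Hausdorff.
Local Open Scope ereal_scope.
Variables (R : realType) (T : Type) (d : T -> T -> R).

Definition diam (U : set T) : \bar R :=
  ereal_sup [set e | e = 0 \/ exists x y, [/\ U x, U y & e = (d x y)%:E]].

Definition hausdorff_premeasure (s delta : R) (A : set T) : \bar R :=
  ereal_inf [set \sum_(0 <= i <oo) poweR (diam (U i)) s | U in
    [set U : (set T)^nat |
       A `<=` \bigcup_i U i /\ forall i, diam (U i) <= delta%:E]].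

Definition hausdorff_measure (s : R) (A : set T) : \bar R :=
  ereal_sup [set hausdorff_premeasure s delta A | delta in [set t | (0 < t)%R]].

(* Only s > 0 is used: this does not change the infimum, and avoids the
   convention for 0^0 (the empty set and singletons have diameter 0). *)
Definition hausdorff_dim (A : set T) : \bar R :=
  ereal_inf [set s%:E | s in [set s | (0 < s)%R /\ hausdorff_measure s A = 0]].

End Hausdorff.

(** * Continued fractions *)

Section ContinuedFraction.
Variable F : finFieldType.

Definition cf_map (x : laurent F) : laurent F :=
  if x == 0 then 0 else x^-1 - laurent_of_poly (intpart x^-1).

(* Digits are numbered from 1. [digit 0] is junk, and every statement below
   restricts to positive indices. *)
Definition digit (n : nat) (x : laurent F) : {poly F} :=
  intpart (iter n.-1 cf_map x)^-1.

Definition posn : set nat := [set n | (0 < n)%N].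

Definition digits (x : laurent F) : set {poly F} := [set digit n x | n in posn].

Definition pdeg (A : {poly F}) : nat := (size A).-1.

Definition poly1 : set {poly F} := [set A | (1 <= pdeg A)%N].

Definition distinct_digits (R : realType) : set (laurent F) :=
  [set x | [/\ Delta R x, ~ rational_laurent x &
    forall m n, (0 < m)%N -> (0 < n)%N -> m <> n -> digit m x <> digit n x]].

Definition distinct_digits_in (R : realType) (S : set {poly F}) : set (laurent F) :=
  [set x | distinct_digits R x /\ digits x `<=` S].

(** * Densities *)

Definition QN (N : nat) (S : set {poly F}) : set {poly F} :=
  [set A | S A /\ (pdeg A <= N)%N].

(* #A for finite A *)
Definition ncard (T : choiceType) (A : set T) : nat := #|` fset_set A|.

(* The quotients are 0 for the finitely many N with a zero denominator. *)
Definition upper_density_poly (R : realType) (U S : set {poly F}) : \bar R :=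
  limn_esup (fun N => ((ncard (QN N U))%:R / (ncard (QN N S))%:R)%:E).

Definition upper_density_nat (R : realType) (B G : set nat) : \bar R :=
  limn_esup (fun N => ((ncard (B `&` [set n | (1 <= n <= N)%N]))%:R
                     / (ncard (G `&` [set n | (1 <= n <= N)%N]))%:R)%:E).

Definition growth_density (R : realType) (S : set {poly F}) (alpha : R) : Prop :=
  1 <= alpha /\ exists gamma1 gamma2 beta : R,
    [/\ 0 < gamma1, 0 < gamma2, 0 <= beta &
      \forall N \near \oo,
        gamma1 * (#|F|%:R `^ (N%:R / alpha)) / (N%:R `^ beta)
          <= (ncard (QN N S))%:R
          <= gamma2 * (#|F|%:R `^ (N%:R / alpha)) / (N%:R `^ beta)].

End ContinuedFraction.

(* Main.v *)
Require Import Defs.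
From HB Require Import structures.
From mathcomp Require Import all_boot all_order all_algebra finmap.
From mathcomp Require Import all_classical all_reals all_analysis.
From mathcomp Require Import zify ring lra.

Set Implicit Arguments.
Unset Strict Implicit.
Unset Printing Implicit Defensive.

Import Order.TTheory GRing.Theory Num.Theory.
Local Open Scope classical_set_scope.
Local Open Scope ring_scope.

(** Since 1/(A+u) - 1/(A+v) = (v-u)/((A+u)(A+v)), the set of points with first
    digits A_1,...,A_n has diameter less than |A_1...A_n|^(-2).

    Upper bound: for s > 1/(2 alpha) the sum over S of |A|^(-2s) converges, so
    all but finitely many digits have total weight at most 1/2; after damping
    the weight of the finitely many others, each of which occurs at most once
    in a word of distinct digits, the covers by cylinders of order n have
    s-cost O((3/4)^n).

    Lower bound: growth density yields, for every large n, a degree m with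
    n^2 < m <= (n+1)^2 in which S has at least q^(m/alpha) / m^c elements.
    A proportion 1/m of the elements of each degree m is reserved, leaving out
    one element of U; thus the reserved set has density zero in S and U minus
    the reserved set has the same degrees as U. Each A in U not reserved
    becomes the digit at its own position, which is at least 2^(deg A); at the
    remaining positions (among them all odd indices) the digit ranges over the
    reserved elements of one degree m of order n^2. The next digit and the
    imposed digits then contribute O(n^2) to a total degree of order n^3, so
    the uniform distribution of mass on this Cantor set is s-Hoelder for all
    s < 1/(2 alpha). *)

(** * Orders, polynomials and integral parts in the field of Laurent series *)

Section LaurentOrder.
Variable F : fieldType.
Implicit Types x y z w : laurent F.

Local Notation LP := laurent_of_poly.

Lemma supp_ge_add x y a : supp_ge x a -> supp_ge y a -> supp_ge (x + y) a.
Proof. by move=> xa ya i ia; rewrite [LHS]/= xa // ya // addr0. Qed.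

Lemma supp_ge_opp x a : supp_ge x a -> supp_ge (- x) a.
Proof. by move=> xa i ia; rewrite [LHS]/= xa // oppr0. Qed.

Lemma supp_ge_sub x y a : supp_ge x a -> supp_ge y a -> supp_ge (x - y) a.
Proof. by move=> xa ya; apply: supp_ge_add => //; exact: supp_ge_opp. Qed.

Lemma supp_ge_mul x y a b : supp_ge x a -> supp_ge y b -> supp_ge (x * y) (a + b).
Proof. exact: supp_mul. Qed.

Lemma supp_ge_le x a b : a <= b -> supp_ge x b -> supp_ge x a.
Proof. by move=> ab xb i ia; apply: xb; exact: lt_le_trans ab. Qed.

Lemma supp_ge0 a : supp_ge (0 : laurent F) a.
Proof. by []. Qed.

Lemma supp_ge_eq0 x : (forall n : nat, supp_ge x n%:Z) -> x = 0.
Proof. by move=> H; apply: laurent_eqP => i; rewrite (H `|i|.+1) //=; lia. Qed.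

Lemma lmul_lead x y a b : supp_ge x a -> supp_ge y b ->
  (x * y : laurent F) (a + b) = x a * y b.
Proof.
move=> xa yb; have := @mul_coefE _ x y a b 0 xa yb.
by rewrite big_ord1 !addr0 => <-.
Qed.

Lemma lone_coef i : (1 : laurent F) i = (i == 0)%:R.
Proof. by []. Qed.

(** By [lmul_lead] the leading coefficients of x and of its inverse multiply to a nonzero
    coefficient of 1, which must sit at index 0. *)
Lemma supp_ge_inv x a : x a != 0 -> supp_ge x a -> supp_ge x^-1 (- a).
Proof.
move=> xa0 xa.
have x0 : x != 0 by apply: contraNneq xa0 => ->.
have [yb0 yb] := ldegP (invr_neq0 x0).
set b := - ldeg x^-1 in yb0 yb.
have := lmul_lead xa yb; rewrite mulfV // lone_coef => H.
have : a + b == 0 by apply: contraT => /negPf ab; move: H; rewrite ab => /esym/eqP; rewrite mulf_eq0 (negPf xa0) (negPf yb0).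
by rewrite addr_eq0 => /eqP ->; rewrite opprK.
Qed.

Lemma lpolyD (p r : {poly F}) : LP (p + r) = LP p + LP r.
Proof.
by apply: laurent_eqP => i /=; case: ifP; rewrite ?addr0 // coefD.
Qed.

Lemma lpolyN (p : {poly F}) : LP (- p) = - LP p.
Proof.
by apply: laurent_eqP => i /=; case: ifP; rewrite ?oppr0 // coefN.
Qed.

Lemma lpolyB (p r : {poly F}) : LP (p - r) = LP p - LP r.
Proof. by rewrite lpolyD lpolyN. Qed.

Lemma lpoly0 : LP 0 = 0 :> laurent F.
Proof. by apply: laurent_eqP => i /=; rewrite coef0 if_same. Qed.

Lemma lpoly_inj : injective (@laurent_of_poly F).
Proof.
move=> p r pr; apply/polyP => i.
have := congr1 (fun x : laurent F => x (- i%:Z)) pr => /=.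
by rewrite !oppr_le0 /= abszN absz_nat.
Qed.

Lemma lpoly_eq0 (p : {poly F}) : (LP p == 0) = (p == 0).
Proof. by rewrite -lpoly0; apply/eqP/eqP => [/lpoly_inj|->]. Qed.

Lemma supp_lpoly (p : {poly F}) : supp_ge (LP p) (- (size p).-1%:Z).
Proof.
move=> i ip /=; case: ifP => // i0; rewrite nth_default //.
by move: (size p) ip => m; lia.
Qed.

Lemma lpolyX_coef i : (LP 'X : laurent F) i = (i == - 1)%:R.
Proof.
rewrite /laurent_of_poly [LHS]/= coefX; case: ifP => h.
  by congr (_%:R); lia.
by case: eqP => // e; move: h; rewrite e.
Qed.

Lemma lpolyC_coef c i : (LP c%:P : laurent F) i = if i == 0 then c else 0.
Proof.
rewrite /laurent_of_poly [LHS]/= coefC.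
have -> : (`|i|%N == 0%N) = (i == 0) by lia.
by case: ifP => // h; case: eqP => // e; move: h; rewrite e.
Qed.

Lemma mulX_coef x i : (LP 'X * x : laurent F) i = x (i + 1).
Proof.
have [b xb] := lcoefP x.
have sX : supp_ge (LP 'X : laurent F) (- 1).
  by move=> j j1; rewrite lpolyX_coef; case: eqP => //; lia.
have [ib|bi] := ltP (i + 1) b.
  by rewrite (supp_ge_mul sX xb) ?xb //; lia.
have -> : i = - 1 + b + `|(i + 1)%R - b|%N%:Z by lia.
rewrite [LHS](mul_coefE _ sX xb) big_ord_recl big1 ?addr0.
  by rewrite lpolyX_coef (_ : (_ == _) = true) // mul1r; congr (x _); rewrite subn0; lia.
move=> j _; rewrite lpolyX_coef lift0 (_ : (_ == _) = false) ?mul0r //.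
Qed.

Lemma mulC_coef c x i : (LP c%:P * x : laurent F) i = c * x i.
Proof.
have [b xb] := lcoefP x.
have sX : supp_ge (LP c%:P : laurent F) 0.
  by move=> j j1; rewrite lpolyC_coef; case: eqP => //; lia.
have [ib|bi] := ltP i b.
  by rewrite (supp_ge_mul sX xb) ?xb ?mulr0 //; lia.
have -> : i = 0 + b + `|i - b|%N%:Z by lia.
rewrite [LHS](mul_coefE _ sX xb) big_ord_recl big1 ?addr0.
  by rewrite lpolyC_coef (_ : (_ == _) = true) //; congr (_ * x _); rewrite subn0; lia.
move=> j _; rewrite lpolyC_coef lift0 (_ : (_ == _) = false) ?mul0r //.
Qed.

(** Both sides are additive in p, so Horner's scheme reduces the claim to multiplication by X, which
    shifts coefficients, and by constants, which scales them. *)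
Lemma lpolyM (p r : {poly F}) : LP (p * r) = LP p * LP r.
Proof.
have hX (s : {poly F}) : LP ('X * s) = LP 'X * LP s.
  apply: laurent_eqP => i; rewrite mulX_coef /= coefXM.
  have [i0|i0] := leP i 0; last by rewrite ifF //; lia.
  have [->|i1] := eqVneq i 0; first by [].
  have -> : (`|i|%N == 0%N) = false by lia.
  have -> : (i + 1 <= 0) = true by lia.
  by congr (s`_ _); lia.
have hC c (s : {poly F}) : LP (c%:P * s) = LP c%:P * LP s.
  by apply: laurent_eqP => i; rewrite mulC_coef /= coefCM; case: ifP; rewrite ?mulr0.
elim/poly_ind: p => [|p c IH]; first by rewrite mul0r lpoly0 mul0r.
rewrite mulrDl !lpolyD hC mulrDl; congr (_ + _).
by rewrite [p * 'X]mulrC -mulrA !hX IH mulrA.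
Qed.

(** Beyond the cut-off in [intpart] the coefficients of x vanish, so the cut-off leaves no trace. *)
Lemma intpart_coef x (k : nat) : (intpart x)`_k = x (- k%:Z).
Proof.
rewrite coef_poly; case: ifP => // kx.
have [->|x0] := eqVneq x 0; first by [].
have [_ ->] := ldegP x0 => //.
by move: kx; lia.
Qed.

Lemma supp_ge_fracpart x : supp_ge (x - LP (intpart x)) 1.
Proof.
move=> i i1 /=; rewrite ifT ?intpart_coef; last lia.
by have -> : - `|i|%N%:Z = i; [lia | rewrite subrr].
Qed.

Lemma intpartD (p : {poly F}) y : supp_ge y 1 -> intpart (LP p + y) = p.
Proof.
move=> y1; apply/polyP => i; rewrite intpart_coef /= y1 ?addr0; last lia.
by rewrite oppr_le0 /= abszN absz_nat.
Qed.

Lemma intpart0 : intpart (0 : laurent F) = 0.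
Proof. by apply/polyP => i; rewrite intpart_coef coef0. Qed.

End LaurentOrder.

(** * Common digits versus the order of a difference *)

Section ContinuedFractionOrder.
Variable F : finFieldType.
Implicit Types x y z : laurent F.
Local Notation LP := laurent_of_poly.

(** Only negative powers of X occur in y, so the leading term of p dominates the sum. *)
Lemma lpoly_lead (p : {poly F}) y : (0 < pdeg p)%N -> supp_ge y 1 ->
  [/\ (LP p + y) (- (pdeg p)%:Z) != 0, supp_ge (LP p + y) (- (pdeg p)%:Z),
      LP p + y != 0 & supp_ge (LP p + y)^-1 (pdeg p)%:Z].
Proof.
move=> p1 y1.
have A : (LP p + y : laurent F) (- (pdeg p)%:Z) != 0.
  rewrite /= y1 ?addr0; last lia.
  rewrite oppr_le0 /= abszN absz_nat /pdeg -/(lead_coef p) lead_coef_eq0.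
  by apply: contraTneq p1 => ->; rewrite /pdeg size_poly0.
have B : supp_ge (LP p + y) (- (pdeg p)%:Z).
  apply: supp_ge_add; first exact: supp_lpoly.
  by apply: supp_ge_le y1; lia.
have C : LP p + y != 0 by apply: contraNneq A => ->.
by split => //; have := supp_ge_inv A B; rewrite opprK.
Qed.

Lemma digitS n x : digit n.+2 x = digit n.+1 (cf_map x).
Proof. by rewrite /digit /= -iterSr. Qed.

Lemma supp_ge_cf_map x : supp_ge (cf_map x) 1.
Proof. by rewrite /cf_map; case: ifP => // _; exact: supp_ge_fracpart. Qed.

(** The inverse of 0 is 0 by convention, so the first digit of 0 is the zero polynomial, whose
    [pdeg] is 0. *)
Lemma digit1_neq0 x : (0 < pdeg (digit 1 x))%N -> x != 0.
Proof.
apply: contraTneq => ->; rewrite /digit /= invr0 intpart0.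
by rewrite /pdeg size_poly0.
Qed.

Lemma inv_digit x : x != 0 -> x^-1 = LP (digit 1 x) + cf_map x.
Proof. by move=> x0; rewrite /cf_map (negPf x0) /digit /= addrC subrK. Qed.

Lemma cf_step x : (0 < pdeg (digit 1 x))%N -> x = (LP (digit 1 x) + cf_map x)^-1.
Proof. by move=> /digit1_neq0 /inv_digit <-; rewrite invrK. Qed.

Lemma cf_mapP (p : {poly F}) y : (0 < pdeg p)%N -> supp_ge y 1 ->
  digit 1 (LP p + y)^-1 = p /\ cf_map (LP p + y)^-1 = y.
Proof.
move=> p1 y1; have [_ _ z0 _] := lpoly_lead p1 y1.
split; first by rewrite /digit /= invrK intpartD.
by rewrite /cf_map invr_eq0 (negPf z0) invrK intpartD // addrC addKr.
Qed.

(** Induction on n: with u = A + x' and v = A + y' for the common first digit A, the identity 1/u -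
    1/v = -(x' - y')/(uv) adds 2 deg A to the order. *)
Lemma supp_ge_cylinder (d : nat -> nat) (n : nat) x y :
  supp_ge x 1 -> supp_ge y 1 ->
  (forall i, (i < n)%N -> digit i.+1 x = digit i.+1 y) ->
  (forall i, (i < n)%N -> pdeg (digit i.+1 x) = d i) ->
  (forall i, (i < n)%N -> (0 < d i)%N) ->
  supp_ge (x - y) (2 * \sum_(i < n) d i)%N%:Z.
Proof.
elim: n d x y => [|n IH] d x y x1 y1 xy xd d0.
  rewrite big_ord0 muln0; apply: supp_ge_sub; [exact: supp_ge_le x1|exact: supp_ge_le y1].
have dx : pdeg (digit 1 x) = d 0%N by rewrite xd.
have px : (0 < pdeg (digit 1 x))%N by rewrite dx d0.
have e := xy 0%N (ltn0Sn n).
have py : (0 < pdeg (digit 1 y))%N by rewrite -e.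
have := IH (d \o S) (cf_map x) (cf_map y) (@supp_ge_cf_map _) (@supp_ge_cf_map _).
move=> /(_ _ _ _) H.
have {H}H : supp_ge (cf_map x - cf_map y) (2 * \sum_(i < n) d i.+1)%N%:Z.
  apply: H => i lin /=; rewrite -?digitS; [exact: xy|exact: xd|exact: d0].
have [_ _ u0 u1] := lpoly_lead px (@supp_ge_cf_map x).
have [_ _ v0 v1] := lpoly_lead py (@supp_ge_cf_map y).
have := cf_step px; have := cf_step py; rewrite -e in v0 v1 *.
set u := LP _ + cf_map x in u0 u1 *; set v := LP _ + cf_map y in v0 v1 *.
have uv : u - v = cf_map x - cf_map y by rewrite /u /v; ring.
move=> yE xE; have -> : x - y = - ((cf_map x - cf_map y) * u^-1 * v^-1).
  by rewrite -uv {1}xE {1}yE; field; rewrite u0 v0.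
have := supp_ge_opp (supp_ge_mul (supp_ge_mul H u1) v1).
apply: supp_ge_le; rewrite big_ord_recl -dx /=.
by rewrite (eq_bigr (fun i : 'I_n => d i.+1)) //; lia.
Qed.

(** Partial converse, for digits of equal degrees. The same identity read backwards costs 2 [d 0]
    per step; thanks to the extra 1, an order of at least 1 remains, which forces the first digits
    to agree. *)
Lemma cylinder_supp_ge (d : nat -> nat) (n : nat) x y :
  (forall i, (i < n)%N -> pdeg (digit i.+1 x) = d i) ->
  (forall i, (i < n)%N -> pdeg (digit i.+1 y) = d i) ->
  (forall i, (i < n)%N -> (0 < d i)%N) ->
  supp_ge (x - y) (2 * \sum_(i < n) d i).+1%N%:Z ->
  forall i, (i < n)%N -> digit i.+1 x = digit i.+1 y.
Proof.
elim: n d x y => [//|n IH] d x y xd yd d0 xy.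
have dx : pdeg (digit 1 x) = d 0%N by rewrite xd.
have dy : pdeg (digit 1 y) = d 0%N by rewrite yd.
have px : (0 < pdeg (digit 1 x))%N by rewrite dx d0.
have py : (0 < pdeg (digit 1 y))%N by rewrite dy d0.
have [_ u1 u0 _] := lpoly_lead px (@supp_ge_cf_map x).
have [_ v1 v0 _] := lpoly_lead py (@supp_ge_cf_map y).
have E : LP (digit 1 x) + cf_map x - (LP (digit 1 y) + cf_map y) =
   - ((x - y) * (LP (digit 1 x) + cf_map x) * (LP (digit 1 y) + cf_map y)).
  have := cf_step px; have := cf_step py.
  set u := LP _ + cf_map x in u0 *; set v := LP _ + cf_map y in v0 *.
  by move=> yE xE; rewrite {1}xE {1}yE; field; rewrite u0 v0.
have := supp_ge_opp (supp_ge_mul (supp_ge_mul xy u1) v1).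
rewrite -{}E dx dy => /supp_ge_le => /(_ (2 * \sum_(i < n) d i.+1).+1%N%:Z) H.
have {}H : supp_ge (LP (digit 1 x) + cf_map x - (LP (digit 1 y) + cf_map y)) (2 * \sum_(i < n) d i.+1).+1%N%:Z.
  by apply: H; rewrite big_ord_recl /= (eq_bigr (fun i : 'I_n => d i.+1)) //; lia.
have e : digit 1 x = digit 1 y.
  apply/eqP; rewrite -subr_eq0; apply/eqP.
  (* The difference of the first digits is the integral part of its sum with a series of order at
     least 1, and by [H] this sum has no coefficient at an index <= 0. *)
  rewrite -[LHS](@intpartD _ _ (cf_map x - cf_map y)); last first.
    by apply: supp_ge_sub; exact: supp_ge_cf_map.
  apply/polyP => k; rewrite intpart_coef coef0 lpolyB.
  rewrite (_ : _ + _ = LP (digit 1 x) + cf_map x - (LP (digit 1 y) + cf_map y)); last by ring.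
  by rewrite H //; lia.
case=> [_ //|i]; rewrite ltnS => lin; rewrite !digitS.
apply: (IH (d \o S)) lin => [j jn|j jn|j jn|] /=.
- by rewrite -digitS xd.
- by rewrite -digitS yd.
- exact: d0.
- move: H; rewrite e; congr (supp_ge _ _); ring.
Qed.

End ContinuedFractionOrder.

(** * Existence of irrational points with prescribed digits *)

Section ContinuedFractionExpansion.
Variable F : finFieldType.
Implicit Types x y z : laurent F.
Local Notation LP := laurent_of_poly.

(** From [c n] on, the coefficients of index below n no longer change, so the limit is read off
    coefficient by coefficient. *)
Lemma laurent_complete (c : nat -> laurent F) :
  (forall n, supp_ge (c n) 0) -> (forall n, supp_ge (c n.+1 - c n) n%:Z) ->
  exists x, forall n, supp_ge (x - c n) n%:Z.
Proof.
move=> c0 cS.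
have stable n k i : i < n%:Z -> c (n + k)%N i = c n i.
  move=> iln; elim: k => [|k IH]; first by rewrite addn0.
  have := cS (n + k)%N i; rewrite addnS -{}IH => H.
  by apply/eqP; rewrite -subr_eq0; apply/eqP/H; lia.
(* For i >= 0, stage |i| + 1 is the first at which coefficient i is final. *)
pose f (i : int) := if i < 0 then 0 else c `|i|.+1 i.
have fP : exists n0 : int, forall i, i < n0 -> f i = 0 by exists 0 => i i0; rewrite /f i0.
exists (Laurent fP) => n i iln /=; rewrite /f; case: ifP => i0.
  by rewrite c0 // subr0.
apply/eqP; rewrite subr_eq0; apply/eqP.
rewrite -(stable _ (n - `|i|.+1)%N i); last lia.
by congr (c _ i); lia.
Qed.

(** The recursion peels off the first digit, as [cf_map] does, and closes the fraction with 0. *)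
Fixpoint cf_convergent (a : nat -> {poly F}) n : laurent F :=
  if n is m.+1 then (LP (a 0%N) + cf_convergent (a \o S) m)^-1 else 0.

Definition digit_seq (a : nat -> {poly F}) := forall n, (0 < pdeg (a n))%N.

Lemma supp_convergent a n : digit_seq a -> supp_ge (cf_convergent a n) 1.
Proof.
elim: n a => [|n IH] a a1; first exact: supp_ge0.
have [||_ _ _] := @lpoly_lead _ (a 0%N) (cf_convergent (a \o S) n); first exact: a1.
  by apply: IH => i; exact: a1.
by apply: supp_ge_le; have := a1 0%N; lia.
Qed.

(** The identity for 1/u - 1/v again: each digit gains an order of at least 2, of which 1 is
    used. *)
Lemma convergent_diff a n : digit_seq a ->
  supp_ge (cf_convergent a n.+1 - cf_convergent a n) n%:Z.
Proof.
elim: n a => [|n IH] a a1.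
  by rewrite subr0; exact: supp_ge_le (supp_convergent _ a1).
have a'1 : digit_seq (a \o S) by move=> i; exact: a1.
have [_ _ u0 u1] := lpoly_lead (a1 0%N) (supp_convergent n.+1 a'1).
have [_ _ v0 v1] := lpoly_lead (a1 0%N) (supp_convergent n a'1).
have -> : cf_convergent a n.+2 - cf_convergent a n.+1 =
  - ((cf_convergent (a \o S) n.+1 - cf_convergent (a \o S) n) *
     (LP (a 0%N) + cf_convergent (a \o S) n.+1)^-1 *
     (LP (a 0%N) + cf_convergent (a \o S) n)^-1).
  rewrite [cf_convergent a n.+2]/= -/(cf_convergent (a \o S) n.+1).
  rewrite [cf_convergent a n.+1]/=.
  move: (cf_convergent (a \o S) n.+1) (cf_convergent (a \o S) n) u0 v0 => u v u0 v0.
  by field; rewrite u0 v0.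
apply: supp_ge_opp; apply: supp_ge_le (supp_ge_mul (supp_ge_mul (IH _ a'1) u1) v1).
by have := a1 0%N; lia.
Qed.

Lemma cf_limit a : digit_seq a ->
  exists x, forall n, supp_ge (x - cf_convergent a n) n%:Z.
Proof.
move=> a1; apply: laurent_complete => n; last exact: convergent_diff.
exact: supp_ge_le (supp_convergent _ a1).
Qed.

Lemma cf_limit_supp a x : digit_seq a ->
  (forall n, supp_ge (x - cf_convergent a n) n%:Z) -> supp_ge x 1.
Proof.
move=> a1 /(_ 1%N) H; rewrite -(subrK (cf_convergent a 1) x).
by apply: supp_ge_add => //; exact: supp_convergent.
Qed.

Lemma cf_limitS a x y : digit_seq a ->
  (forall n, supp_ge (x - cf_convergent a n) n%:Z) ->
  (forall n, supp_ge (y - cf_convergent (a \o S) n) n%:Z) ->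
  x = (LP (a 0%N) + y)^-1.
Proof.
move=> a1 xa ya; have a'1 : digit_seq (a \o S) by move=> i; exact: a1.
have y1 := cf_limit_supp a'1 ya.
have [_ u1 u0 _] := lpoly_lead (a1 0%N) y1.
suff : x * (LP (a 0%N) + y) - 1 = 0.
  by move/eqP; rewrite subr_eq0 => /eqP H; apply: (mulIf u0); rewrite H mulVf.
apply: supp_ge_eq0 => n.
(* The surplus [pdeg (a 0)] compensates the negative order of the factor [LP (a 0) + y]. *)
pose N := (n + pdeg (a 0%N))%N.
have [_ v1 v0 _] := lpoly_lead (a1 0%N) (supp_convergent N a'1).
have c1 := supp_convergent N.+1 a1.
(* The convergent of order N + 1 is the inverse of [LP (a 0)] plus the convergent of order N of the
   shifted sequence. *)
have -> : x * (LP (a 0%N) + y) - 1 = (x - cf_convergent a N.+1) * (LP (a 0%N) + y)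
    + cf_convergent a N.+1 * (y - cf_convergent (a \o S) N).
  rewrite [cf_convergent a N.+1]/=; move: (cf_convergent _ N) v0 => v v0.
  by field.
apply: supp_ge_add.
  by apply: supp_ge_le (supp_ge_mul (xa N.+1) u1); rewrite /N; lia.
by apply: supp_ge_le (supp_ge_mul c1 (ya N)); rewrite /N; lia.
Qed.

(** [cf_map] runs Euclid's algorithm: it sends P/Q to (Q mod P)/P, and the size of the numerator
    drops. *)
Lemma rational_terminates x : rational_laurent x -> exists n, iter n (@cf_map F) x = 0.
Proof.
move=> [P [Q [Q0 ->]]].
elim: {P}_.+1 {-2}P (ltnSn (size P)) Q Q0 => [//|k IH] P; rewrite ltnS => Pk Q Q0.
have [->|P0] := eqVneq P 0; first by exists 0%N; rewrite lpoly0 mul0r.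
have LP0 : LP P != 0 by rewrite lpoly_eq0.
have LQ0 : LP Q != 0 by rewrite lpoly_eq0.
have frac : supp_ge (LP (Q %% P) / LP P) 1.
  have P1 : LP P (- (size P).-1%:Z) != 0.
    by rewrite /= oppr_le0 /= abszN absz_nat -/(lead_coef P) lead_coef_eq0.
  have := supp_ge_mul (@supp_lpoly _ (Q %% P)) (supp_ge_inv P1 (@supp_lpoly _ P)).
  have [->|m0] := eqVneq (Q %% P) 0; first by rewrite lpoly0 mul0r.
  apply: supp_ge_le; have := ltn_modp Q P; rewrite P0.
  by move: m0; rewrite -size_poly_gt0; move: (size P) (size (Q %% P)) => a b; lia.
have step : cf_map (LP P / LP Q) = LP (Q %% P) / LP P.
  rewrite /cf_map mulf_eq0 invr_eq0 (negPf LP0) (negPf LQ0) /= invfM invrK.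
  have -> : (LP P)^-1 * LP Q = LP (Q %/ P) + LP (Q %% P) / LP P.
    rewrite {1}(divp_eq Q P) lpolyD lpolyM.
    by field.
  by rewrite intpartD // addrC addKr.
have [|n nE] := IH (Q %% P) _ P P0.
  by apply: leq_trans Pk; rewrite ltn_modp.
by exists n.+1; rewrite iterSr step.
Qed.

(** The iterates of the limit under [cf_map] are the limits of the tails of [a]. None of them is 0,
    which by [rational_terminates] excludes rationality. *)
Lemma cf_expansion a : digit_seq a -> exists x,
  [/\ supp_ge x 1, ~ rational_laurent x & forall n, digit n.+1 x = a n].
Proof.
move=> a1.
(* A limit is chosen for all sequences at once, so that the tails are treated together; outside
   [digit_seq] the value is junk. *)
have /choice [L LP] : forall b, exists x, digit_seq b ->
    forall n, supp_ge (x - cf_convergent b n) n%:Z.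
  move=> b; have [/cf_limit [x xP]|b1] := pselect (digit_seq b); first by exists x.
  by exists 0.
have step b : digit_seq b -> L b = (laurent_of_poly (b 0%N) + L (b \o S))^-1.
  move=> b1; apply: cf_limitS => //; first exact: LP.
  by apply: LP => i; exact: b1.
have dS b : digit_seq b -> [/\ digit 1 (L b) = b 0%N, cf_map (L b) = L (b \o S),
    L b != 0 & supp_ge (L b) 1].
  move=> b1; have b'1 : digit_seq (b \o S) by move=> i; exact: b1.
  have s1 := cf_limit_supp b'1 (LP _ b'1).
  have [h1 h2] := cf_mapP (b1 0%N) s1; have [_ _ h3 h4] := lpoly_lead (b1 0%N) s1.
  by split; rewrite ?(step b b1) ?invr_eq0 //; apply: supp_ge_le h4; exact: b1.
have tail_digit n : digit_seq (fun i => a (n + i)%N) by move=> i; exact: a1.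
have itL n : iter n (@cf_map F) (L a) = L (fun i => a (n + i)%N).
  elim: n => [//|n IH]; rewrite iterS IH.
  have [_ -> _ _] := dS _ (tail_digit n).
  by congr L; apply/funext => i /=; rewrite addnS addSn.
exists (L a); split.
- by have [] := dS _ a1.
- by move=> /rational_terminates [n] /eqP; rewrite itL; have [_ _ /negPf-> _] := dS _ (tail_digit n).
move=> n; rewrite /digit [n.+1.-1]/= itL.
by have [h _ _ _] := dS _ (tail_digit n); move: h; rewrite /digit /= addn0.
Qed.

End ContinuedFractionExpansion.

(** * The norm in terms of orders *)

Section Norm.
Variables (R : realType) (F : finFieldType).
Implicit Types x : laurent F.
Local Notation q := (#|F|%:R : R).

Lemma card_field_gt1 : 1 < q.
Proof. by rewrite ltr1n card_finNzRing_gt1. Qed.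

Lemma lnorm_le x (k : nat) : supp_ge x k%:Z -> lnorm R x <= q^-1 ^+ k.
Proof.
have q0 : 0 < q := lt_trans ltr01 card_field_gt1.
move=> xk; rewrite /lnorm; case: eqVneq => [_|x0].
  by rewrite exprn_ge0 // invr_ge0 ltW.
have [h _] := ldegP x0.
rewrite exprVn exprnN ler_eXz2l ?card_field_gt1 // leNgt; apply: contra h => h.
by rewrite xk //; lia.
Qed.

Lemma lnorm_ge x (k : nat) : ~ supp_ge x k.+1%:Z -> q^-1 ^+ k <= lnorm R x.
Proof.
move=> xk; rewrite /lnorm; case: eqVneq => [x0|x0].
  by exfalso; apply: xk; rewrite x0; exact: supp_ge0.
have [_ h] := ldegP x0.
rewrite exprVn exprnN ler_eXz2l ?card_field_gt1 // leNgt; apply/negP => hk; apply: xk.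
by apply: supp_ge_le h; lia.
Qed.

Lemma DeltaP x : Delta R x <-> supp_ge x 1.
Proof.
split=> [xD|x1].
  apply: contrapT => /(@lnorm_ge _ 0); rewrite expr0 leNgt.
  by move: xD; rewrite /Delta /= => ->.
rewrite /Delta /=; apply: le_lt_trans (@lnorm_le x 1 x1) _.
by rewrite expr1 invf_lt1 ?card_field_gt1 // (lt_trans ltr01) // card_field_gt1.
Qed.

End Norm.

(** * Branches that avoid cylinders of small total mass *)

Section AvoidCylinders.
Variables (R : realType) (T : eqType) (D : nat -> seq T).
Hypothesis D_uniq : forall k, uniq (D k).
Hypothesis D_neq0 : forall k, D k != [::].

(** Mass of a cylinder of order n under the product of the uniform measures on the [D i]; this
    measure enters the proof only through these numbers. *)
Definition cyl_mass (n : nat) : R := \prod_(i < n) (size (D i))%:R^-1.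

Lemma cyl_mass_gt0 n : 0 < cyl_mass n.
Proof.
by apply: prodr_gt0 => i _; rewrite invr_gt0 ltr0n lt0n size_eq0.
Qed.

Lemma cyl_massS n : (size (D n))%:R * cyl_mass n.+1 = cyl_mass n.
Proof.
rewrite /cyl_mass big_ord_recr /= mulrCA mulfV ?mulr1 //.
by rewrite pnatr_eq0 size_eq0.
Qed.

(* Descend the tree of words, always moving to a child whose mass is not
   exhausted by the cylinders contained in it. *)
Lemma avoid_cylinders (d : nat -> nat -> T) (n : nat -> nat) :
  (\sum_(0 <= i <oo) (cyl_mass (n i))%:E < 1)%E ->
  exists a : nat -> T, (forall k, a k \in D k) /\
    forall i, exists2 k, (k < n i)%N & a k != d i k.
Proof.
move=> mass1.
(* [M l i] is the mass of the i-th cylinder if its word extends l, and 0 otherwise; [m l] below is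
   the total forbidden mass inside the cylinder of l. *)
pose M (l : seq T) i : R :=
  if (mkseq (d i) (size l) == l) && (size l <= n i)%N then cyl_mass (n i) else 0.
have M_ge0 l i : (0 <= (M l i)%:E)%E.
  by rewrite lee_fin /M; case: ifP => // _; exact/ltW/cyl_mass_gt0.
pose m l := (\sum_(0 <= i <oo) (M l i)%:E)%E.
(* If all children were exhausted, their forbidden masses would add up to at least the mass of l. *)
have m_child l : (m l < (cyl_mass (size l))%:E)%E ->
    exists b, (b \in D (size l)) && (m (rcons l b) < (cyl_mass (size l).+1)%:E)%E.
  move=> ml; apply: contrapT => H; move: ml; apply/negP; rewrite -leNgt.
  have {}H b : b \in D (size l) -> ((cyl_mass (size l).+1)%:E <= m (rcons l b))%E.
    by move=> bD; rewrite leNgt; apply: contra_notN H => h; exists b; rewrite bD.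
  apply: (@le_trans _ _ (\sum_(b <- D (size l)) m (rcons l b))%E).
    rewrite -cyl_massS big_seq_cond.
    apply: (@le_trans _ _ (\sum_(b <- D (size l) | (b \in D (size l)) && true)
        (cyl_mass (size l).+1)%:E)%E); last by apply: lee_sum => b /andP[/H].
    by rewrite -big_seq_cond sumEFin lee_fin big_const_seq count_predT iter_addr_0 mulr_natl.
  rewrite -nneseries_sum //; apply: lee_nneseries => [i _ _|i _].
    by apply: sume_ge0.
  rewrite sumEFin lee_fin.
  (* A cylinder properly inside that of l meets at most one child; any other one contributes nothing
     to the children. *)
  have [x0|] := boolP ((mkseq (d i) (size l) == l) && (size l < n i)%N); last first.
    move=> h; rewrite big1 => [|b _]; first by rewrite -lee_fin.
    rewrite /M size_rcons mkseqS eqseq_rcons; case: ifP => // /andP[/andP[h1 _] h2].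
    by rewrite h1 h2 in h.
  have [e h] := andP x0; rewrite {2}/M e ltnW //=.
  rewrite (eq_bigr (fun b => if b == d i (size l) then cyl_mass (n i) else 0)).
    rewrite -big_mkcond /= big_const_seq iter_addr_0.
    apply: (@le_trans _ _ (cyl_mass (n i) *+ 1)); last by rewrite mulr1n.
    apply: ler_wpMn2l; first exact/ltW/cyl_mass_gt0.
    by rewrite count_uniq_mem //; case: (_ \in _).
  by move=> b _; rewrite /M size_rcons mkseqS eqseq_rcons e h /= andbT eq_sym.
have x0 : T.
  by move: (D_neq0 0); case: (D 0%N).
have /choice [f fP] : forall l, exists b, (m l < (cyl_mass (size l))%:E)%E ->
    (b \in D (size l)) && (m (rcons l b) < (cyl_mass (size l).+1)%:E)%E.
  move=> l; have [/m_child[b bP]|h] := pselect (m l < (cyl_mass (size l))%:E)%E.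
    by exists b.
  by exists x0.
pose L := fix L k : seq T := if k is k'.+1 then rcons (L k') (f (L k')) else [::].
pose a k := f (L k).
have LE k : L k = mkseq a k by elim: k => [//|k IH]; rewrite mkseqS -IH.
have LP k : (m (L k) < (cyl_mass (size (L k)))%:E)%E.
  elim: k => [|k IH].
    rewrite /m /= /cyl_mass big_ord0; apply: le_lt_trans mass1.
    by apply: lee_nneseries => // i _; rewrite lee_fin /M /=.
  by have /andP[_ h] := fP _ IH; rewrite /= size_rcons.
exists a; split => [k|i].
  by have /andP[] := fP _ (LP k); rewrite {2}LE size_mkseq.
(* Otherwise the branch runs into the i-th forbidden cylinder, which alone exhausts the mass of its
   word, against [LP]. *)
apply: contrapT => H.
have {}H k : (k < n i)%N -> a k = d i k.
  by move=> kn; apply/eqP/negPn/negP => h; apply: H; exists k.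
have Ld : L (n i) = mkseq (d i) (n i).
  by rewrite LE; apply/eq_in_map => k; rewrite mem_iota add0n => /andP[_] /H.
have := LP (n i); rewrite ltNge => /negP; apply.
apply: le_trans (nneseries_lim_ge i.+1 _) => //.
rewrite big_nat_recr //=.
apply: (@le_trans _ _ (M (L (n i)) i)%:E).
  by rewrite lee_fin /M Ld size_mkseq eqxx leqnn.
by rewrite leeDr //; apply: sume_ge0.
Qed.

End AvoidCylinders.

(** * General bounds for Hausdorff measure and dimension *)

Section HausdorffGeneral.
Local Open Scope ereal_scope.
Variables (R : realType) (T : Type) (d : T -> T -> R).
Implicit Types A B : set T.

Lemma diam_ge0 (V : set T) : 0 <= diam d V.
Proof. by apply: ereal_sup_ubound; left. Qed.

Lemma diam_le (V : set T) (r : R) : (0 <= r)%R ->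
  (forall x y, V x -> V y -> (d x y <= r)%R) -> diam d V <= r%:E.
Proof.
move=> r0 H; apply: ge_ereal_sup => e [->|[x [y [Vx Vy ->]]]]; rewrite lee_fin //.
exact: H.
Qed.

Lemma diam_ge (V : set T) x y : V x -> V y -> (d x y)%:E <= diam d V.
Proof. by move=> Vx Vy; apply: ereal_sup_ubound; right; exists x, y. Qed.

Lemma hausdorff_premeasure_ge0 s delta A : 0 <= hausdorff_premeasure d s delta A.
Proof.
by apply: le_ereal_inf_tmp => _ [V _ <-]; apply: nneseries_ge0 => n _ _; exact: poweR_ge0.
Qed.

Lemma hausdorff_premeasure_le s delta A B :
  A `<=` B -> hausdorff_premeasure d s delta A <= hausdorff_premeasure d s delta B.
Proof.
move=> AB; apply: ereal_inf_le_tmp => _ [V [VB Vd] <-]; exists V => //; split => //.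
exact: subset_trans VB.
Qed.

Lemma hausdorff_measure_ge0 s A : 0 <= hausdorff_measure d s A.
Proof.
apply: (@le_trans _ _ (hausdorff_premeasure d s 1 A)).
  exact: hausdorff_premeasure_ge0.
by apply: ereal_sup_ubound; exists 1%R => //=.
Qed.

Lemma hausdorff_measure_le s A B :
  A `<=` B -> hausdorff_measure d s A <= hausdorff_measure d s B.
Proof.
move=> AB; apply: ge_ereal_sup => _ [delta d0 <-].
apply: le_trans (hausdorff_premeasure_le _ _ AB) _.
by apply: ereal_sup_ubound; exists delta.
Qed.

Lemma hausdorff_dim_le A B : A `<=` B -> hausdorff_dim d A <= hausdorff_dim d B.
Proof.
move=> AB; apply: ereal_inf_le_tmp => _ [s [s0 sB] <-]; exists s => //; split => //.
by apply/eqP; rewrite eq_le hausdorff_measure_ge0 andbT -sB; exact: hausdorff_measure_le.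
Qed.

Lemma hausdorff_measure_eq0 s A :
  (forall delta eps : R, (0 < delta)%R -> (0 < eps)%R ->
    exists V : (set T)^nat, [/\ A `<=` \bigcup_i V i,
      forall i, diam d (V i) <= delta%:E &
      \sum_(0 <= i <oo) poweR (diam d (V i)) s <= eps%:E]) ->
  hausdorff_measure d s A = 0.
Proof.
move=> H; apply/eqP; rewrite eq_le hausdorff_measure_ge0 andbT.
apply: ge_ereal_sup => _ [delta /= d0 <-].
apply/lee_addgt0Pr => e e0; rewrite add0e.
have [V [V1 V2 V3]] := H _ _ d0 e0.
by apply: le_trans V3; apply: ereal_inf_lbound; exists V.
Qed.

(** The measure is a supremum over the scales, so a lower bound for the covers at one scale is
    enough. *)
Lemma hausdorff_measure_neq0 s A (delta c : R) : (0 < delta)%R -> (0 < c)%R ->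
  (forall V : (set T)^nat, A `<=` \bigcup_i V i ->
      (forall i, diam d (V i) <= delta%:E) ->
      c%:E <= \sum_(0 <= i <oo) poweR (diam d (V i)) s) ->
  hausdorff_measure d s A <> 0.
Proof.
move=> d0 c0 H h.
have : c%:E <= hausdorff_measure d s A.
  apply: (@le_trans _ _ (hausdorff_premeasure d s delta A)).
    by apply: le_ereal_inf_tmp => _ [V [V1 V2] <-]; exact: H.
  by apply: ereal_sup_ubound; exists delta.
by rewrite h lee_fin leNgt c0.
Qed.

Lemma hausdorff_dim_ub A (s0 : R) : (0 < s0)%R ->
  (forall s, (s0 < s)%R -> hausdorff_measure d s A = 0) ->
  hausdorff_dim d A <= s0%:E.
Proof.
move=> s0_gt0 H; apply/lee_addgt0Pr => e e0; rewrite -EFinD.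
apply: ereal_inf_lbound; exists (s0 + e)%R => //; split; first by rewrite addr_gt0.
by apply: H; rewrite ltrDl.
Qed.

Lemma hausdorff_dim_lb A (s0 : R) :
  (forall s, (0 < s < s0)%R -> hausdorff_measure d s A <> 0) ->
  s0%:E <= hausdorff_dim d A.
Proof.
move=> H; apply: le_ereal_inf_tmp => _ [s [sp sA] <-]; rewrite lee_fin leNgt.
by apply/negP => h; apply: (H s) => //; rewrite sp.
Qed.

End HausdorffGeneral.

(** * Mass distribution principle for Cantor sets of continued fractions *)

Section CantorLowerBound.
Variables (R : realType) (F : finFieldType).
Local Notation qi := ((#|F|%:R : R)^-1).

(** Positions are counted from 0 while digits are numbered from 1; [supp_ge x 1] expresses
    membership in [Delta]. *)
Definition cf_cantor (D : nat -> seq {poly F}) : set (laurent F) :=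
  [set x | [/\ supp_ge x 1, ~ rational_laurent x & forall n, digit n.+1 x \in D n]].

Lemma qi_gt0 : 0 < qi.
Proof. by rewrite invr_gt0 (lt_trans ltr01) // card_field_gt1. Qed.

Lemma qi_lt1 : qi < 1.
Proof. by rewrite invf_lt1 ?card_field_gt1 // (lt_trans ltr01) // card_field_gt1. Qed.

Lemma expr_small (z eps : R) : 0 <= z -> z < 1 -> 0 < eps ->
  exists n, forall m, (n <= m)%N -> z ^+ m <= eps.
Proof.
move=> z0 z1 e0; have /cvgrPdist_le : z ^+ n @[n --> \oo] --> 0.
  by apply: cvg_expr; rewrite ger0_norm.
move=> /(_ _ e0)[n _ H]; exists n => m nm.
have := H m nm; rewrite sub0r normrN ger0_norm //.
exact: exprn_ge0.
Qed.

Lemma powR_exprn (x s : R) n : 0 <= x -> (x ^+ n) `^ s = (x `^ s) ^+ n.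
Proof.
by move=> x0; rewrite -[x ^+ n]powR_mulrn // -powRrM (mulrC n%:R) powRrM powR_mulrn // powR_ge0.
Qed.

(** Let T n be the sum of [t i] over i < n. A set of diameter r with q^(-2 T (n+1)) <= r < q^(-2 T
    n) meets the Cantor set within one cylinder of order n, of mass at most c r^s. Hence the mass at
    order n is compared with the degrees up to and including [t n]. A cheap cover would have total
    mass below 1 and miss a branch. *)
Lemma cantor_measure_neq0 (D : nat -> seq {poly F}) (t : nat -> nat) (s c : R) :
  0 < s -> 0 < c ->
  (forall k, uniq (D k)) -> (forall k, D k != [::]) ->
  (forall k, (0 < t k)%N) -> (forall k A, A \in D k -> pdeg A = t k) ->
  (forall n, cyl_mass R D n <= c * (qi ^+ (2 * \sum_(i < n.+1) t i)) `^ s) ->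
  hausdorff_measure (@ldist R F) s (cf_cantor D) <> 0.
Proof.
move=> s0 c0 Du Dn t0 Dt massle.
pose T n := (\sum_(i < n) t i)%N.
have T_ge n : (n <= T n)%N.
  rewrite /T -[X in (X <= _)%N]card_ord -sum1_card; apply: leq_sum => i _; exact: t0.
have mass_small eps : 0 < eps -> exists n, cyl_mass R D n <= eps.
  move=> e0.
  have [|||n nP] := @expr_small (qi `^ s) (eps / c).
  - exact: powR_ge0.
  - rewrite [ltRHS](_ : 1 = (1 : R) `^ s); last by rewrite powR1.
    by apply: gt0_ltr_powR => //; rewrite ?qi_lt1 ?nnegrE ?ler01 ?(ltW qi_gt0) //.
  - exact: divr_gt0.
  exists n; apply: le_trans (massle n) _.
  rewrite mulrC -ler_pdivlMr // powR_exprn ?(ltW qi_gt0) //.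
  by apply: nP; have := T_ge n.+1; rewrite /T; lia.
have agree x y n : cf_cantor D x -> cf_cantor D y ->
    ldist R x y < qi ^+ (2 * T n) -> forall k, (k < n)%N -> digit k.+1 x = digit k.+1 y.
  move=> [x1 _ xD] [y1 _ yD] xy.
  apply: (@cylinder_supp_ge _ t) => [i _|i _|i _|].
  - exact: Dt.
  - exact: Dt.
  - exact: t0.
  apply: contrapT => /(@lnorm_ge R); rewrite -/(ldist R x y) leNgt.
  by rewrite -/(T n) xy.
have [A0 A0D] : exists a, forall k, a k \in D k.
  exists (fun k => head 0 (D k)) => k.
  by case: (D k) (Dn k) => [//|A l _]; rewrite mem_head.
(* To V is attached a cylinder [p.1] of order [p.2] containing the part of the Cantor set in V. The
   slack eps serves sets of diameter 0 or disjoint from the Cantor set, which have no critical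
   order. *)
have cover (V : set (laurent F)) (eps : R) : (diam (@ldist R F) V <= (2^-1)%:E)%E -> 0 < eps ->
    exists p : (nat -> {poly F}) * nat,
      ((cyl_mass R D p.2)%:E <= c%:E * poweR (diam (@ldist R F) V) s + eps%:E)%E /\
      forall x, V x -> cf_cantor D x -> forall k, (k < p.2)%N -> digit k.+1 x = p.1 k.
  move=> V2 e0; have [n0 n0P] := mass_small _ e0.
  have e_ok : ((cyl_mass R D n0)%:E <= c%:E * poweR (diam (@ldist R F) V) s + eps%:E)%E.
    apply: (@le_trans _ _ (0 + eps%:E)%E); first by rewrite add0e lee_fin.
    by rewrite leeD2r // mule_ge0 ?poweR_ge0 // lee_fin ltW.
  have [[x0 [Vx0 cx0]]|VC] := pselect (exists x, V x /\ cf_cantor D x); last first.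
    by exists (A0, n0); split => // x Vx cx; exfalso; apply: VC; exists x.
  have := diam_ge0 (@ldist R F) V; have := @diam_ge _ _ (@ldist R F) V.
  move: e_ok V2; case: (diam _ V) => [r|//|//]; rewrite !lee_fin => e_ok r2 rP r0.
  have {}rP x y : V x -> V y -> ldist R x y <= r.
    by move=> Vx Vy; have := rP _ _ Vx Vy; rewrite lee_fin.
  have ok n : r < qi ^+ (2 * T n) -> forall x, V x -> cf_cantor D x ->
      forall k, (k < n)%N -> digit k.+1 x = digit k.+1 x0.
    by move=> rn x Vx cx; apply: agree => //; apply: le_lt_trans rn; exact: rP.
  have [re|rn0] := eqVneq r 0.
    exists (fun k => digit k.+1 x0, n0); split => //=; apply: ok.
    by rewrite re exprn_gt0 // qi_gt0.
  have ex : exists n, qi ^+ (2 * T n) <= r.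
    have [|||n nP] := @expr_small qi r.
    - by rewrite ltW // qi_gt0.
    - exact: qi_lt1.
    - by rewrite lt0r rn0.
    by exists n; apply: nP; have := T_ge n; lia.
  (* The least n with q^(-2 T n) <= r is not 0, because r <= 1/2; its predecessor m is the order
     sought. *)
  case: (ex_minnP ex) => -[|m] mP mmin.
    by exfalso; move: mP; rewrite /T big_ord0 expr0 => h; lra.
  exists (fun k => digit k.+1 x0, m); split => /=; last first.
    by apply: ok; rewrite ltNge; apply/negP => /mmin; rewrite ltnn.
  rewrite ?poweR_EFin -EFinM -EFinD lee_fin.
  apply: le_trans (massle m) _; rewrite -[leLHS]addr0 lerD ?(ltW e0) // ler_pM2l //.
  by apply: ge0_ler_powR; rewrite ?nnegrE // ltW.
(* A cover of cost below 1/(2c) yields cylinders of total mass below c/(2c) + 1/4 = 3/4, the 1/4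
   being the sum of the slacks. *)
apply: (@hausdorff_measure_neq0 _ _ _ _ _ 2^-1 (2 * c)^-1).
- by rewrite invr_gt0.
- by rewrite invr_gt0 mulr_gt0.
move=> V Vcov Vd; rewrite leNgt; apply/negP => sum_lt.
have /choice [p pP] : forall i, exists p : (nat -> {poly F}) * nat,
  ((cyl_mass R D p.2)%:E <= c%:E * poweR (diam (@ldist R F) (V i)) s
     + (4^-1 / (2 ^ i.+1)%:R)%:E)%E /\
  forall x, V i x -> cf_cantor D x -> forall k, (k < p.2)%N -> digit k.+1 x = p.1 k.
  by move=> i; apply: cover => //; rewrite divr_gt0 ?invr_gt0 // ltr0n expn_gt0.
have [] := @avoid_cylinders R _ D Du Dn (fun i => (p i).1) (fun i => (p i).2).
  apply: (@le_lt_trans _ _ (\sum_(0 <= i <oo) (c%:E * poweR (diam (@ldist R F) (V i)) s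
     + (4^-1 / (2 ^ i.+1)%:R)%:E))%E).
    apply: lee_nneseries => [i _ _|i _]; last by have [] := pP i.
    by rewrite lee_fin ltW // cyl_mass_gt0.
  apply: le_lt_trans (epsilon_trick _ _ _) _ => [i||].
  - by rewrite mule_ge0 ?poweR_ge0 // lee_fin ltW.
  - by rewrite invr_ge0.
  rewrite nneseriesZl => [|i _]; last exact: poweR_ge0.
  apply: (@le_lt_trans _ _ (c%:E * ((2 * c)^-1)%:E + (4^-1)%:E)%E).
    by rewrite leeD2r // lee_pmul2l ?lte_fin // ltW.
  rewrite -EFinM -EFinD lte_fin invfM mulrCA mulfV ?gt_eqF // mulr1; lra.
move=> a [aD aP].
have [x [x1 xr xa]] : exists x, [/\ supp_ge x 1, ~ rational_laurent x & forall n, digit n.+1 x = a n].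
  by apply: cf_expansion => n; rewrite (Dt _ _ (aD n)).
have cx : cf_cantor D x by split => // n; rewrite xa.
have [i _ Vix] := Vcov x cx.
have [_ H] := pP i; have [k kn /eqP] := aP i; apply.
by rewrite -xa; exact: H.
Qed.

End CantorLowerBound.

(** * Covers by cylinders with distinct digits *)

Section CoveringUpperBound.
Variables (R : realType) (F : finFieldType).
Local Notation qi := ((#|F|%:R : R)^-1).

Lemma ler_sum_subset (T : eqType) (L M : seq T) (f : T -> R) :
  (forall x, 0 <= f x) -> uniq L -> {subset L <= M} ->
  \sum_(x <- L) f x <= \sum_(x <- M) f x.
Proof.
move=> f0; elim: L M => [|x L IH] M /=.
  by move=> _ _; rewrite big_nil; apply: sumr_ge0.
move=> /andP[xL uL] LM; have xM : x \in M by apply: LM; rewrite mem_head.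
rewrite big_cons (perm_big _ (perm_to_rem xM)) big_cons lerD2l; apply: IH => // y yL.
apply: rem_mem; last by apply: LM; rewrite inE yL orbT.
by apply: contraNneq xL => <-.
Qed.

(** Expanding the power gives the sum over all words of length n with letters in X. *)
Lemma words_sum_le (T : eqType) (w : T -> R) (X : seq T) (L : seq (seq T)) n :
  (forall a, 0 <= w a) -> uniq L ->
  (forall l, l \in L -> size l = n /\ {subset l <= X}) ->
  \sum_(l <- L) \prod_(a <- l) w a <= (\sum_(a <- X) w a) ^+ n.
Proof.
move=> w0 uL LX.
pose words := fix words n : seq (seq T) :=
  if n is m.+1 then [seq a :: l | a <- X, l <- words m] else [:: [::]].
have -> : (\sum_(a <- X) w a) ^+ n = \sum_(l <- words n) \prod_(a <- l) w a.
  elim: (n) => [|m IH]; first by rewrite expr0 big_seq1 big_nil.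
  rewrite exprS IH [words _]/= big_allpairs_dep big_distrl /=; apply: eq_bigr => a _.
  by rewrite big_distrr /=; apply: eq_bigr => l _; rewrite big_cons.
apply: ler_sum_subset => // [l|l lL]; first by apply: prodr_ge0.
have [<- {lL}] := LX _ lL; elim: l => [//|a l IH] lX.
apply/allpairsP; exists (a, l); split => //=; first by apply: lX; rewrite mem_head.
by apply: IH => b bl; apply: lX; rewrite inE bl orbT.
Qed.

Lemma finite_QN N (S : set {poly F}) : finite_set (QN N S).
Proof.
pose f (u : {ffun 'I_N.+1 -> F}) : {poly F} := \poly_(i < N.+1) (if insub i is Some j then u j else 0).
apply: (@sub_finite_set _ _ (f @` [set: {ffun 'I_N.+1 -> F}])); last first.
  by apply: finite_image; exact: finite_finset.
move=> A [_ AN]; exists [ffun i : 'I_N.+1 => A`_i] => //.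
apply/polyP => i; rewrite coef_poly; case: ltnP => iN.
  by rewrite insubT ffunE.
rewrite nth_default // (leq_trans _ iN) //.
by move: AN; rewrite /pdeg; case: (size A).
Qed.

Lemma mem_QN N (S : set {poly F}) A :
  A \in fset_set (QN N S) <-> S A /\ (pdeg A <= N)%N.
Proof. by rewrite in_fset_set ?inE //; exact: finite_QN. Qed.

Definition cylinder (l : seq {poly F}) : set (laurent F) :=
  [set x | supp_ge x 1 /\ forall i, (i < size l)%N -> digit i.+1 x = nth 0 l i].

Lemma diam_cylinder (l : seq {poly F}) : (forall A, A \in l -> (0 < pdeg A)%N) ->
  (diam (@ldist R F) (cylinder l) <= (qi ^+ (2 * \sum_(A <- l) pdeg A))%:E)%E.
Proof.
move=> l0; apply: diam_le => [|x y [x1 xl] [y1 yl]].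
  by rewrite exprn_ge0 // ltW // qi_gt0.
apply: lnorm_le; rewrite (big_nth 0) big_mkord.
apply: (@supp_ge_cylinder _ (fun i => pdeg (nth 0 l i))) => // i il.
- by rewrite xl ?yl.
- by rewrite xl.
- by apply: l0; exact: mem_nth.
Qed.

Lemma measure_distinct_digits_eq0 (S : set {poly F}) (s : R) (M : nat) :
  0 < s -> S `<=` @poly1 F ->
  (forall X : seq {poly F}, uniq X ->
     (forall A, A \in X -> S A /\ (M < pdeg A)%N) ->
     \sum_(A <- X) (qi ^+ (2 * pdeg A)) `^ s <= 2^-1) ->
  hausdorff_measure (@ldist R F) s (distinct_digits_in R S) = 0.
Proof.
move=> s0 S1 HM.
pose w (A : {poly F}) : R := (qi ^+ (2 * pdeg A)) `^ s.
have qi0 : 0 <= qi := ltW (qi_gt0 R F).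
have w0 A : 0 <= w A by exact: powR_ge0.
have w1 A : w A <= 1.
  rewrite /w powR_exprn //; apply: exprn_ile1; first exact: powR_ge0.
  rewrite [leRHS](_ : 1 = (1 : R) `^ s); last by rewrite powR1.
  by apply: ge0_ler_powR; rewrite ?nnegrE ?ler01 ?(ltW s0) ?(ltW (qi_lt1 R F)).
pose K := size (fset_set (QN M S)).
(* Damped by eta, the at most K digits of degree <= M weigh at most 1/4 together. *)
pose eta : R := (4 * K.+1%:R)^-1.
have K0 : 0 < 4 * K.+1%:R :> R by rewrite mulr_gt0.
have eta0 : 0 < eta by rewrite invr_gt0.
have eta1 : eta <= 1.
  rewrite invf_le1 //; have : 1 <= K.+1%:R :> R by rewrite ler1n.
  by move: (K.+1%:R) => k; lra.
pose w' A := (if (pdeg A <= M)%N then eta else 1) * w A.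
have w'0 A : 0 <= w' A by rewrite /w' mulr_ge0 //; case: ifP => // _; exact: ltW.
(* Distinctness enters here: each of the K damped digits occurs at most once in l, so undoing the
   damping costs at most a factor eta^(-K), whatever the length of l. *)
have prod_w l : uniq l -> (forall A, A \in l -> S A) ->
    \prod_(A <- l) w A <= eta^-1 ^+ K * \prod_(A <- l) w' A.
  move=> ul lS; rewrite /w' big_split /= mulrA.
  rewrite -[leLHS]mul1r ler_wpM2r ?prodr_ge0 //.
  rewrite -big_mkcond /= big_const_seq iter_mulr_1 exprVn mulrC ler_pdivlMr ?exprn_gt0 //.
  rewrite mul1r ler_wiXn2l ?(ltW eta0) // -size_filter.
  apply: uniq_leq_size; first exact: filter_uniq.
  by move=> A; rewrite mem_filter => /andP[AM Al]; apply/mem_QN; split => //; exact: lS.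
have sum_w' X : uniq X -> (forall A, A \in X -> S A) -> \sum_(A <- X) w' A <= 3 / 4.
  move=> uX XS; rewrite (bigID (fun A => pdeg A <= M)%N) /=.
  have -> : 3 / 4 = 4^-1 + 2^-1 :> R by lra.
  apply: lerD.
    apply: (@le_trans _ _ (\sum_(A <- X | (pdeg A <= M)%N) eta)).
      by apply: ler_sum => A AM; rewrite /w' AM ler_piMr // ltW.
    rewrite big_const_seq iter_addr_0 -[leLHS]mulr_natr.
    have cK : (count (fun A => pdeg A <= M)%N X <= K)%N.
      rewrite -size_filter; apply: uniq_leq_size; first exact: filter_uniq.
      by move=> A; rewrite mem_filter => /andP[AM AX]; apply/mem_QN; split => //; exact: XS.
    apply: (@le_trans _ _ (eta * K.+1%:R)).
      by apply: ler_wpM2l; [exact: ltW|rewrite ler_nat leqW].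
    by rewrite /eta invfM -mulrA mulVf ?mulr1 // pnatr_eq0.
  rewrite -big_filter; rewrite (eq_big_seq w); last first.
    by move=> A; rewrite mem_filter /w' => /andP[/negPf-> _]; rewrite mul1r.
  apply: HM; first exact: filter_uniq.
  by move=> A; rewrite mem_filter -ltnNge => /andP[-> /XS].
apply: hausdorff_measure_eq0 => delta eps d0 e0.
have [n [n1 n2]] : exists n, qi ^+ n <= delta /\ eta^-1 ^+ K * (3 / 4) ^+ n <= eps.
  have [a aP] := expr_small qi0 (qi_lt1 R F) d0.
  have [|||b bP] := @expr_small R (3 / 4) (eps / eta^-1 ^+ K).
  - lra.
  - lra.
  - by rewrite divr_gt0 // exprn_gt0 // invr_gt0.
  exists (maxn a b); split; first by rewrite aP // leq_maxl.
  by rewrite mulrC -ler_pdivlMr ?bP ?leq_maxr // exprn_gt0 // invr_gt0.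
pose ok (l : seq {poly F}) := [&& size l == n, uniq l & `[< forall A, A \in l -> S A >]].
(* Covers are indexed by integers, so words are enumerated through their codes; an integer that
   codes no admissible word gives the empty set, whose cost is 0 as s > 0. *)
pose h i := obind (fun l => if ok l then Some l else None)
  (@choice.pickle_inv (seq {poly F}) i).
have h_ok i l : h i = Some l -> ok l.
  by rewrite /h; case: choice.pickle_inv => //= l'; case: ifP => // ? [<-].
have hK : ocancel h choice.pickle.
  move=> i; have := @choice.pickle_invK (seq {poly F}) i.
  by rewrite /h; case: choice.pickle_inv => //= l; case: ifP.
exists (fun i => oapp cylinder set0 (h i)); split.
- move=> x [[/DeltaP x1 _ xdist] xS].
  pose l := mkseq (fun i => digit i.+1 x) n.
  exists (choice.pickle l) => //.
  have okl : ok l.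
    apply/and3P; split; first by rewrite size_mkseq.
      apply/mkseq_uniqP => i j _ _ ij; apply: contrapT => ne.
      by apply: (xdist i.+1 j.+1) ij => // -[].
    by apply/asboolP => A /mapP[i _ ->]; apply: xS; exists i.+1.
  rewrite /h choice.pickleK_inv /= okl /=; split => // i.
  by rewrite size_mkseq => il; rewrite nth_mkseq.
- move=> i; case E : (h i) => [l|] /=; last first.
    by apply: diam_le => //; exact: ltW.
  have /and3P[/eqP ln _ /asboolP lS] := h_ok _ _ E.
  have l0 A : A \in l -> (0 < pdeg A)%N by move=> /lS /S1.
  apply: le_trans (diam_cylinder l0) _; rewrite lee_fin; apply: le_trans n1.
  rewrite ler_wiXn2l ?qi0 // ?(ltW (qi_lt1 R F)) //.
  apply: (@leq_trans (\sum_(A <- l) 1)%N).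
    by rewrite sum1_size ln.
  rewrite mul2n -addnn; apply: leq_trans (leq_addr _ _).
  by rewrite big_seq [leqRHS]big_seq; apply: leq_sum => A /l0.
- have term i : (poweR (diam (@ldist R F) (oapp cylinder set0 (h i))) s <=
      (oapp (fun l => \prod_(A <- l) w A) 0 (h i))%:E)%E.
    case E : (h i) => [l|] /=; last first.
      suff -> : diam (@ldist R F) set0 = 0%E by rewrite poweR0r // gt_eqF.
      by apply/eqP; rewrite eq_le diam_ge0 andbT; exact: diam_le.
    have /and3P[/eqP ln _ /asboolP lS] := h_ok _ _ E.
    have l0 A : A \in l -> (0 < pdeg A)%N by move=> /lS /S1.
    have -> : \prod_(A <- l) w A = (qi ^+ (2 * \sum_(A <- l) pdeg A)) `^ s.
      elim: (l) => [|A l' IH]; first by rewrite !big_nil muln0 expr0 powR1.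
      by rewrite !big_cons IH mulnDr exprD powRM ?exprn_ge0.
    rewrite -poweR_EFin; apply: gt0_ler_poweR; rewrite ?(ltW s0) //.
    + by rewrite in_itv /= diam_ge0 leey.
    + by rewrite in_itv /= lee_fin exprn_ge0 // leey.
    + exact: diam_cylinder.
  apply: lime_le; first by apply: is_cvg_nneseries => i _ _; exact: poweR_ge0.
  apply: nearW => N; rewrite big_mkord.
  apply: (@le_trans _ _ (\sum_(i < N) (oapp (fun l => \prod_(A <- l) w A) 0 (h i))%:E)%E).
    by apply: lee_sum => i _; exact: term.
  rewrite sumEFin lee_fin; apply: le_trans n2.
  rewrite -(big_mkord xpredT (fun i => oapp (fun l => \prod_(A <- l) w A) 0 (h i))).
  rewrite -big_pmap.
  set L := pmap h _.
  have uL : uniq L by apply: (pmap_uniq hK); exact: iota_uniq.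
  have L_ok l : l \in L -> ok l.
    by rewrite mem_pmap => /mapP[i _ /esym /h_ok].
  apply: (@le_trans _ _ (\sum_(l <- L) eta^-1 ^+ K * \prod_(A <- l) w' A)).
    rewrite big_seq [leRHS]big_seq; apply: ler_sum => l /L_ok /and3P[_ ul /asboolP lS].
    exact: prod_w.
  rewrite -big_distrr /= ler_pM2l ?exprn_gt0 ?invr_gt0 //.
  (* The words of a partial sum have their letters in a finite alphabet X, so [words_sum_le] bounds
     the damped sum by (3/4)^n. *)
  pose X := undup (flatten L).
  have XS A : A \in X -> S A.
    by rewrite mem_undup => /flattenP[l /L_ok /and3P[_ _ /asboolP lS]]; exact: lS.
  apply: le_trans (@words_sum_le _ w' X L n w'0 uL _) _.
    move=> l lL; have /and3P[/eqP ln _ _] := L_ok _ lL; split => // A Al.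
    by rewrite mem_undup; apply/flattenP; exists l.
  apply: lerXn2r; rewrite ?nnegrE ?sumr_ge0 //.
  by apply: sum_w' => //; exact: undup_uniq.
Qed.

End CoveringUpperBound.

(** * Consequences of growth density and convergence of the weights *)

Section GrowthDensity.
Variables (R : realType) (F : finFieldType).
Local Notation q := (#|F|%:R : R).
Local Notation qi := (q^-1).

(** Each of the first n terms of the geometric series is at least y^n. *)
Lemma nat_expr_le (y : R) n : 0 <= y -> y < 1 -> n%:R * y ^+ n <= (1 - y)^-1.
Proof.
move=> y0 y1; have y'0 : 0 < 1 - y by rewrite subr_gt0.
rewrite -div1r ler_pdivlMr //.
apply: (@le_trans _ _ ((\sum_(i < n) y ^+ i) * (1 - y))).
  rewrite ler_pM2r //; apply: (@le_trans _ _ (\sum_(i < n) y ^+ n)).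
    by rewrite sumr_const card_ord mulr_natl.
  by apply: ler_sum => i _; rewrite ler_wiXn2l ?(ltW y1) // ltnW.
by rewrite mulrC -opprB mulNr -subrX1 opprB gerBl exprn_ge0.
Qed.

(** With y the (k+1)-th root of z, n^k z^n = (n y^n)^k y^n, where the first factor is bounded by
    [nat_expr_le]. *)
Lemma natX_expr_small (z eps : R) k : 0 <= z -> z < 1 -> 0 < eps ->
  exists n0, forall n, (n0 <= n)%N -> n%:R ^+ k * z ^+ n <= eps.
Proof.
move=> z0 z1 e0; pose y := z `^ (k.+1%:R^-1).
have y0 : 0 <= y by exact: powR_ge0.
have yz : y ^+ k.+1 = z by rewrite -powR_mulrn // -powRrM mulVf ?powRr1 // pnatr_eq0.
have y1 : y < 1.
  by rewrite ltNge; apply: contraTN z1 => y1; rewrite -leNgt -yz exprn_ege1.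
pose C := (1 - y)^-1; have C0 : 0 < C by rewrite invr_gt0 subr_gt0.
have [n0 H] := expr_small y0 y1 (divr_gt0 e0 (exprn_gt0 k C0)).
exists n0 => n /H; rewrite ler_pdivlMr ?exprn_gt0 // => {}H; apply: le_trans H.
rewrite -yz -exprM mulnC exprM exprSr mulrA -exprMn [leRHS]mulrC.
apply: ler_wpM2r; first exact: exprn_ge0.
by apply: lerXn2r; rewrite ?nnegrE ?(ltW C0) ?mulr_ge0 ?exprn_ge0 // nat_expr_le.
Qed.

(** For N >= 1, beta can be rounded up to an integer in the lower bound, and the division by N^beta
    >= 1 dropped in the upper one. *)
Lemma growth_bounds (S : set {poly F}) (alpha : R) : growth_density S alpha ->
  exists (g1 g2 : R) (b N0 : nat), [/\ 0 < g1, 0 < g2 &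
    forall N, (N0 <= N)%N ->
      g1 * (q `^ alpha^-1) ^+ N <= N%:R ^+ b * (ncard (QN N S))%:R /\
      (ncard (QN N S))%:R <= g2 * (q `^ alpha^-1) ^+ N].
Proof.
move=> [_ [g1 [g2 [beta [g10 g20 beta0 [N0 _ H]]]]]].
exists g1, g2, (Num.bound beta), N0.+1; split => // N N0N.
have /andP[] := H N (ltnW N0N).
have -> : q `^ (N%:R / alpha) = (q `^ alpha^-1) ^+ N.
  by rewrite -powR_mulrn ?powR_ge0 // -powRrM mulrC.
have N1 : 1 <= N%:R :> R by rewrite ler1n; case: (N) N0N.
have Nb0 : 0 < N%:R `^ beta by rewrite powR_gt0 // (lt_le_trans ltr01).
move: (_ ^+ N) (exprn_ge0 N (powR_ge0 q alpha^-1)) => A A0.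
rewrite ler_pdivrMr // ler_pdivlMr // => h1 h2; split.
  rewrite mulrC in h1 *; apply: le_trans h1 _.
  rewrite mulrC ler_wpM2r // -powR_mulrn ?(le_trans ler01) // ler_powR //.
  by rewrite ltW // (le_lt_trans _ (archi_boundP beta0)) // ler_norm.
apply: le_trans h2; rewrite ler_peMr //.
by rewrite -[leLHS](powRr0 (N%:R : R)) ler_powR.
Qed.

Lemma ltr_powR_exponent (x y : R) : x < y -> q `^ x < q `^ y.
Proof.
have q1 := card_field_gt1 R F.
move=> xy; rewrite /powR !gt_eqF ?(lt_trans ltr01) //.
by rewrite ltr_expR ltr_pM2r // ln_gt0.
Qed.

Lemma growth_rate_gt1 (alpha : R) : 0 < alpha -> 1 < q `^ alpha^-1.
Proof.
by move=> a0; rewrite -[ltLHS](powRr0 q) ltr_powR_exponent // invr_gt0.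
Qed.

Lemma qi_powR_sqr (s : R) : (qi `^ s) ^+ 2 = (q `^ (2 * s))^-1.
Proof.
have q0 : 0 <= q by exact: ler0n.
rewrite -powR_inv1 // -powRrM mulN1r powRN exprVn; congr (_^-1).
by rewrite -powR_mulrn ?powR_ge0 // -powRrM mulrC.
Qed.

Lemma weight_lt1 (alpha s : R) : 0 < alpha -> (2 * alpha)^-1 < s ->
  0 <= q `^ alpha^-1 * (qi `^ s) ^+ 2 < 1.
Proof.
move=> a0 H; rewrite mulr_ge0 ?exprn_ge0 ?powR_ge0 //= qi_powR_sqr.
have q0 : 0 < q := lt_trans ltr01 (card_field_gt1 R F).
rewrite ltr_pdivrMr ?powR_gt0 // mul1r; apply: ltr_powR_exponent.
by move: H; rewrite invfM; lra.
Qed.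

Lemma weight_gt1 (alpha s : R) : 0 < alpha -> s < (2 * alpha)^-1 ->
  q `^ (2 * s) < q `^ alpha^-1.
Proof.
by move=> a0 H; apply: ltr_powR_exponent; move: H; rewrite invfM; lra.
Qed.

(** There are at most g a^d elements of degree d, each of weight r^d, so the tail is dominated by a
    geometric series of ratio a r. *)
Lemma tail_weight (S : set {poly F}) (a g r : R) (N0 : nat) :
  0 <= a -> 0 <= r -> a * r < 1 -> 0 < g ->
  (forall N, (N0 <= N)%N -> (ncard (QN N S))%:R <= g * a ^+ N) ->
  exists M, forall X : seq {poly F}, uniq X ->
    (forall A, A \in X -> S A /\ (M < pdeg A)%N) ->
    \sum_(A <- X) r ^+ pdeg A <= 2^-1.
Proof.
move=> a0 r0 z1 g0 cardS; pose z := a * r.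
have z0 : 0 <= z by rewrite mulr_ge0.
have z'0 : 0 < 1 - z by rewrite subr_gt0.
pose C := g / (1 - z); have C0 : 0 < C by rewrite divr_gt0.
have [|n0 n0P] := @expr_small R z (2^-1 / C) z0 z1; first by rewrite divr_gt0 // invr_gt0.
pose M := maxn n0 N0; exists M => X uX XS.
(* The bound telescopes: g z^d = C (z^d - z^(d+1)). *)
have step D : (M <= D)%N ->
    \sum_(A <- X | (pdeg A <= D)%N) r ^+ pdeg A <= C * (z ^+ M.+1 - z ^+ D.+1).
  move=> MD; rewrite -(subnKC MD); elim: (D - M)%N => [|k IH].
    rewrite addn0 subrr mulr0 big_seq_cond big1 // => A /andP[/XS[_ h] h'].
    by move: h'; rewrite leqNgt h.
  rewrite addnS; set d := (M + k).+1 in IH *.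
  rewrite (bigID (fun A => pdeg A == d)) /= addrC.
  have -> : C * (z ^+ M.+1 - z ^+ d.+1) = C * (z ^+ M.+1 - z ^+ d) + g * z ^+ d.
    by rewrite [z ^+ d.+1]exprS /C; field; rewrite gt_eqF.
  apply: lerD.
    rewrite (eq_bigl (fun A => pdeg A <= M + k)%N) // => A.
    by rewrite [in LHS]leq_eqVlt ltnS; case: eqP => [->|_] /=; rewrite ?andbF ?andbT // leqNgt leqnn.
  rewrite (eq_bigl (fun A => pdeg A == d)); last first.
    by move=> A; case: eqP => [->|_]; rewrite ?andbF // leqnn.
  rewrite (eq_bigr (fun=> r ^+ d)) => [|A /eqP-> //].
  rewrite big_const_seq iter_addr_0 -[leLHS]mulr_natl exprMn mulrA.
  apply: ler_wpM2r; first exact: exprn_ge0.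
  apply: le_trans (cardS d _); last by apply: leqW; rewrite (leq_trans (leq_maxr n0 N0)) // leq_addr.
  rewrite ler_nat -size_filter; apply: uniq_leq_size; first exact: filter_uniq.
  by move=> A; rewrite mem_filter => /andP[/eqP Ad /XS[SA _]]; apply/mem_QN; rewrite Ad.
pose D := maxn M (\max_(A <- X) pdeg A).
have := step D (leq_maxl _ _).
have -> : \sum_(A <- X | (pdeg A <= D)%N) r ^+ pdeg A = \sum_(A <- X) r ^+ pdeg A.
  rewrite big_seq_cond [RHS]big_seq_cond; apply: eq_bigl => A; rewrite andbT.
  case AX: (A \in X) => //=; rewrite leq_max; apply/orP; right.
  by rewrite (big_rem A) //= leq_maxl.
move=> /le_trans; apply.
apply: (@le_trans _ _ (C * z ^+ M.+1)).
  by rewrite ler_pM2l // gerBl exprn_ge0.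
rewrite mulrC -ler_pdivlMr //; apply: n0P.
by rewrite (leq_trans (leq_maxl n0 N0)).
Qed.

End GrowthDensity.

(** * Counting by degree and finding populated degrees *)

Section DegreeCounts.
Variables (R : realType) (F : finFieldType).
Implicit Types X S U : set {poly F}.

Definition deg_part X (d : nat) : set {poly F} := X `&` [set A | pdeg A = d].

Definition deg_count X d : nat := ncard (deg_part X d).

Lemma finite_deg_part X d : finite_set (deg_part X d).
Proof. by apply: sub_finite_set (finite_QN d X) => A [XA /= <-]; split. Qed.

Lemma mem_deg_part X d A : A \in fset_set (deg_part X d) <-> X A /\ pdeg A = d.
Proof. by rewrite in_fset_set ?inE //; exact: finite_deg_part. Qed.

Lemma ncard_le (X Y : set {poly F}) : finite_set Y -> X `<=` Y -> (ncard X <= ncard Y)%N.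
Proof.
move=> fY XY; have fX := sub_finite_set XY fY.
apply: uniq_leq_size; first exact: fset_uniq.
by move=> A; rewrite !in_fset_set // !inE; exact: XY.
Qed.

Lemma card_QNS X N : ncard (QN N.+1 X) = (ncard (QN N X) + deg_count X N.+1)%N.
Proof.
rewrite /ncard /deg_count /ncard.
have -> : QN N.+1 X = QN N X `|` deg_part X N.+1.
  apply/seteqP; split => A /=.
    by move=> [XA]; rewrite leq_eqVlt => /orP[/eqP ?|?]; [right|left].
  by move=> [[XA AN]|[XA /= AN]]; split => //; rewrite ?AN // leqW.
rewrite fset_setU; [|exact: finite_QN|exact: finite_deg_part].
rewrite cardfsU; set I := (_ `&` _)%fset.
have -> : I = fset0; last by rewrite cardfs0 subn0.
apply/fsetP => A; rewrite in_fsetI in_fset0; apply/negP => /andP[/mem_QN[_ h]].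
by move=> /mem_deg_part[_ h']; move: h; rewrite h' ltnn.
Qed.

Lemma card_QN_le X N M : (N <= M)%N -> (ncard (QN N X) <= ncard (QN M X))%N.
Proof.
move=> NM; apply: ncard_le; first exact: finite_QN.
by move=> A [XA AN]; split => //; exact: leq_trans NM.
Qed.

Lemma card_QN_sum X N k :
  ncard (QN (N + k)%N X) = (ncard (QN N X) + \sum_(i < k) deg_count X (N + i).+1)%N.
Proof.
elim: k => [|k IH]; first by rewrite addn0 big_ord0 addn0.
by rewrite addnS card_QNS IH big_ord_recr /= addnA.
Qed.

Lemma deg_count_le_QN X d : (deg_count X d <= ncard (QN d X))%N.
Proof.
apply: ncard_le; first exact: finite_QN.
by move=> A [XA /= <-]; split.
Qed.

Lemma succ_sq n : (n.+1 ^ 2 = n ^ 2 + n.*2.+1)%N.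
Proof. by rewrite -!mulnn; lia. Qed.

(** If all degrees in the window were poor, the count up to (n+1)^2 would be at most the count up to
    n^2, smaller than A = a^((n+1)^2) by a factor of order a^(-n), plus 2n+1 terms of size
    A/n^(2b+2). This contradicts the lower bound of order A/n^(2b). *)
Lemma deg_window S (a g1 g2 : R) (b N0 : nat) : 1 < a -> 0 < g1 -> 0 < g2 ->
  (forall N, (N0 <= N)%N ->
      g1 * a ^+ N <= N%:R ^+ b * (ncard (QN N S))%:R /\
      (ncard (QN N S))%:R <= g2 * a ^+ N) ->
  exists n0, forall n, (n0 <= n)%N -> exists m,
    [/\ (n ^ 2 < m)%N, (m <= n.+1 ^ 2)%N &
        a ^+ m <= m%:R ^+ b.+1 * (deg_count S m)%:R].
Proof.
move=> a1 g10 g20 H.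
have a0 : 0 < a := lt_trans ltr01 a1.
have z0 : 0 <= a^-1 by rewrite invr_ge0 ltW.
have z1 : a^-1 < 1 by rewrite invf_lt1.
have [|n1 P1] := @natX_expr_small R (a^-1) (g1 / 4 / g2 / 4 ^+ b) (2 * b) z0 z1.
  by rewrite !divr_gt0 // exprn_gt0.
(* C k bounds 4^b (2k+1) for k >= 1; the choices of n1 and n2 make each of the terms [t1] and [t2]
   below at most a quarter of g1 A. *)
pose C : R := 3 * 4 ^+ b; have C0 : 0 < C by rewrite mulr_gt0 // exprn_gt0.
pose n2 := Num.bound (4 * C / g1).
have P2 : 4 * C / g1 < n2%:R.
  by apply: archi_boundP; rewrite divr_ge0 ?mulr_ge0 // ltW.
exists (maxn (maxn n1 n2) (maxn N0 1)) => n.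
rewrite !geq_max => /andP[/andP[n1n n2n] /andP[N0n n0]].
apply: contrapT => none.
have small m : (n ^ 2 < m)%N -> (m <= n.+1 ^ 2)%N ->
    m%:R ^+ b.+1 * (deg_count S m)%:R <= a ^+ m.
  move=> h1 h2; rewrite leNgt; apply: contra_notN none => h.
  by exists m; split => //; exact: ltW.
pose A := a ^+ (n.+1 ^ 2); have A0 : 0 < A by rewrite exprn_gt0.
pose k := n%:R : R.
have k1 : 1 <= k by rewrite ler1n.
have k0 : 0 < k := lt_le_trans ltr01 k1.
have kS : n.+1%:R = k + 1 :> R by rewrite -natr1.
have each i : (i < n.*2.+1)%N -> (deg_count S (n ^ 2 + i).+1)%:R <= A / k ^+ (2 * b.+1).
  move=> i2; rewrite ler_pdivlMr ?exprn_gt0 //.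
  have h2 : ((n ^ 2 + i).+1 <= n.+1 ^ 2)%N by rewrite succ_sq -addnS leq_add2l.
  have h1 : (n ^ 2 < (n ^ 2 + i).+1)%N by rewrite ltnS leq_addr.
  apply: le_trans (le_trans (small _ h1 h2) _); last by rewrite ler_eXn2l.
  rewrite mulrC; apply: ler_wpM2r; first exact: ler0n.
  rewrite exprM -[k ^+ 2]natrX; apply: lerXn2r; rewrite ?nnegrE ?ler0n // ler_nat; exact: ltnW.
have N0n' : (N0 <= n ^ 2)%N.
  by apply: leq_trans N0n _; rewrite -mulnn leq_pmulr.
have [_ up] := H _ N0n'.
have [|lo _] := H (n.+1 ^ 2)%N.
  by rewrite succ_sq (leq_trans N0n') ?leq_addr.
have up' : a ^+ (n ^ 2) <= A * (a^-1) ^+ n.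
  rewrite /A succ_sq exprD -mulrA ler_peMr ?exprn_ge0 ?(ltW a0) //.
  rewrite exprVn ler_pdivlMr ?exprn_gt0 // mul1r ler_eXn2l // -addnn -addSn leq_addl //.
have {}up := le_trans up (ler_wpM2l (ltW g20) up').
have card_le : (ncard (QN (n.+1 ^ 2)%N S))%:R <=
    g2 * (A * (a^-1) ^+ n) + (2 * k + 1) * (A / k ^+ (2 * b.+1)).
  rewrite succ_sq card_QN_sum natrD; apply: lerD => //.
  rewrite natr_sum; apply: (@le_trans _ _ (\sum_(i < n.*2.+1) A / k ^+ (2 * b.+1))).
    by apply: ler_sum => i _; exact: each.
  rewrite sumr_const card_ord -[leLHS]mulr_natl.
  apply: ler_wpM2r; first by apply: divr_ge0; [exact: ltW | exact/exprn_ge0/ltW].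
  by rewrite -natr1 -muln2 natrM mulrC.
have pow_le : (n.+1 ^ 2)%:R ^+ b <= 4 ^+ b * k ^+ (2 * b) :> R.
  have k4 : (n.+1 ^ 2)%:R <= 4 * k ^+ 2 :> R by rewrite natrX kS !expr2; nra.
  rewrite exprM -exprMn; apply: lerXn2r k4; rewrite nnegrE ?ler0n //.
  by apply: mulr_ge0 => //; apply/exprn_ge0/ltW.
have := le_trans lo (ler_pM (exprn_ge0 b (ler0n R _)) (ler0n _ _) pow_le card_le).
apply/negP; rewrite -ltNge -/A.
have e1 := P1 n n1n; rewrite -/k in e1.
have e2 : 4 * C <= g1 * k.
  by rewrite [leRHS]mulrC -ler_pdivrMr //; apply: le_trans (ltW P2) _; rewrite ler_nat.
have Q0 : 0 < 4 ^+ b :> R by rewrite exprn_gt0.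
have P0 : 0 < k ^+ (2 * b) by rewrite exprn_gt0.
have t1 : 4 ^+ b * k ^+ (2 * b) * (g2 * (A * a^-1 ^+ n)) <= g1 / 4 * A.
  have -> : 4 ^+ b * k ^+ (2 * b) * (g2 * (A * a^-1 ^+ n)) =
    (k ^+ (2 * b) * a^-1 ^+ n) * (4 ^+ b * g2) * A by ring.
  rewrite ler_pM2r // -ler_pdivlMr ?mulr_gt0 //; apply: le_trans e1 _.
  by rewrite invfM mulrA [in leRHS]mulrAC.
have t2 : 4 ^+ b * k ^+ (2 * b) * ((2 * k + 1) * (A / k ^+ (2 * b.+1))) <= g1 / 4 * A.
  have -> : 4 ^+ b * k ^+ (2 * b) * ((2 * k + 1) * (A / k ^+ (2 * b.+1))) =
    4 ^+ b * (2 * k + 1) / k ^+ 2 * A.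
    by rewrite mulnS addnC exprD; field; rewrite !gt_eqF.
  rewrite ler_pM2r // ler_pdivrMr ?exprn_gt0 //.
  apply: (@le_trans _ _ (C * k)).
    by rewrite /C -mulrA mulrCA ler_pM2l //; lra.
  by rewrite expr2 mulrA ler_pM2r //; lra.
have gA : 0 < g1 * A by rewrite mulr_gt0.
by rewrite mulrDr; lra.
Qed.

End DegreeCounts.

(** * Free positions outweigh imposed ones *)

Section MassEstimate.
Variable R : realType.

Lemma sum_ord_lt_le (f : nat -> nat) n n1 :
  (\sum_(i < n | (i < n1)%N) f i <= \sum_(i < n1) f i)%N.
Proof.
rewrite (big_ord_widen_cond (n + n1) (fun i => i < n1)%N f (leq_addr _ _)).
rewrite (big_ord_widen (n + n1) f (leq_addl _ _)).
rewrite [leqRHS]big_mkcond /= [leqLHS]big_mkcond /=; apply: leq_sum => i _.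
by case: (i < n1)%N; case: (i < n)%N.
Qed.

(** Induction on j = n/2, since (j+1)^3 - j^3 = 3j^2 + 3j + 1 <= (2j+1)^2. *)
Lemma sum_odd_sq_ge n : (n./2 ^ 3 <= \sum_(i < n | odd i) i ^ 2)%N.
Proof.
have even_case j : (j ^ 3 <= \sum_(i < j.*2 | odd i) i ^ 2)%N.
  elim: j => [//|j IH]; rewrite doubleS big_mkcond !big_ord_recr -big_mkcond /=.
  rewrite odd_double /= addn0; apply: leq_trans (leq_add IH (leqnn _)).
  by rewrite -muln2 !expnS !expn0 !muln1; nia.
pose s k := (\sum_(i < k | odd i) i ^ 2)%N.
rewrite -/(s n) -[X in s X](odd_double_half n) addnC.
case: (odd n); last by rewrite addn0.
rewrite addn1 /s big_mkcond big_ord_recr -big_mkcond /=.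
by apply: leq_trans (leq_addr _ _).
Qed.

Lemma cubic_dominates K C n0 : exists n2, forall n, (n2 <= n)%N ->
  (K * (n ^ 2 + (n + n0).+1 ^ 2) + C <= \sum_(i < n | odd i) i ^ 2)%N.
Proof.
(* With j = n/2 this makes both squares at most (3j)^2, so the left side is at most (18K + C) j^2 <=
   j^3. *)
exists (n0 + 2 + 18 * K + C).*2 => n nb; apply: leq_trans (sum_odd_sq_ge n).
have := odd_double_half n; move: (n./2) => j nj.
have j_ge : (n0 + 2 + 18 * K + C <= j)%N by move: nb nj; case: (odd n); lia.
have n_le : (n <= j.*2.+1)%N by move: nj; case: (odd n); lia.
have h1 : (n ^ 2 <= 9 * j ^ 2)%N.
  by rewrite (_ : 9 = 3 ^ 2)%N // -expnMn leq_exp2r //; lia.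
have h2 : ((n + n0).+1 ^ 2 <= 9 * j ^ 2)%N.
  by rewrite (_ : 9 = 3 ^ 2)%N // -expnMn leq_exp2r //; lia.
have h3 : (C <= C * j ^ 2)%N by rewrite leq_pmulr // expn_gt0; lia.
apply: (@leq_trans ((18 * K + C) * j ^ 2)).
  rewrite mulnDl; apply: leq_add => //.
  rewrite (_ : 18 * K * j ^ 2 = K * (18 * j ^ 2))%N; last by rewrite mulnAC mulnC.
  by rewrite leq_mul2l; apply/orP; right; move: h1 h2; lia.
by rewrite [leqRHS]expnS leq_mul2r; apply/orP; right; lia.
Qed.

(* The singleton positions and the single next position are negligible
   against the free positions, whose total degree grows cubically. *)
Lemma mass_estimate (sz t : nat -> nat) (free : pred nat) (B B' : R) n0 n1 :
  1 <= B -> B < B' -> (forall n, (0 < sz n)%N) ->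
  (forall n, odd n -> free n) ->
  (forall n, free n -> (n ^ 2 <= t n)%N /\ (t n <= (n + n0).+1 ^ 2)%N) ->
  (forall n, ~~ free n -> (t n <= n)%N) ->
  (forall n, (n1 <= n)%N -> free n -> B' ^+ t n <= (sz n)%:R) ->
  exists2 c : R, 0 < c & forall n,
    \prod_(i < n) (sz i)%:R^-1 <= c * B^-1 ^+ (\sum_(i < n.+1) t i).
Proof.
move=> B1 BB' sz0 odd_free free_t sing_t free_sz.
have B0 : 0 < B := lt_le_trans ltr01 B1.
have B'0 : 0 < B' := lt_trans B0 BB'.
(* [Fr] is the free degree available for the mass bound, [E] bounds the degree of the imposed digits
   and of the next one, and [C0] that of the first n1 positions. *)
pose Fr n := (\sum_(i < n | free i && (n1 <= i)) t i)%N.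
pose E n := (n ^ 2 + (n + n0).+1 ^ 2)%N.
pose C0 := (\sum_(i < n1) t i)%N.
pose T n := (\sum_(i < n.+1) t i)%N.
have prod_le n : \prod_(i < n) (sz i)%:R^-1 <= B'^-1 ^+ Fr n.
  rewrite /Fr.
  have -> : B'^-1 ^+ (\sum_(i < n | free i && (n1 <= i)) t i)%N =
      \prod_(i < n) (if free i && (n1 <= i)%N then B'^-1 ^+ t i else 1).
    rewrite -big_mkcond /=.
    exact: (big_morph (fun k => B'^-1 ^+ k) (exprD B'^-1) (expr0 B'^-1)).
  apply: ler_prod => i _; rewrite invr_ge0 ler0n /=.
  case: ifP => [/andP[fi ni]|_].
    by rewrite exprVn lef_pV2 ?posrE ?exprn_gt0 ?ltr0n // free_sz.
  by rewrite invf_le1 ?ltr0n // ler1n.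
have t_le n : (t n <= (n + n0).+1 ^ 2)%N.
  have [/free_t[]//|/sing_t h] := boolP (free n).
  by apply: (leq_trans h); rewrite -mulnn; nia.
have T_le n : (T n <= C0 + Fr n + E n)%N.
  rewrite /T big_ord_recr /= /E addnA; apply: leq_add; last exact: t_le.
  rewrite (bigID (fun i : 'I_n => free i && (n1 <= i)%N)) /= -/(Fr n).
  rewrite [(C0 + _)%N]addnC -addnA leq_add2l.
  apply: (@leq_trans (\sum_(i < n) ((if (i < n1)%N then t i else 0) + i))%N).
    rewrite [leqLHS]big_mkcond; apply: leq_sum => i _; rewrite negb_and -ltnNge.
    case: (i < n1)%N; first by rewrite orbT leq_addr.
    by rewrite orbF; case: ifP => // /sing_t.
  rewrite big_split /= -big_mkcond; apply: leq_add; first exact: sum_ord_lt_le.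
  apply: (@leq_trans (\sum_(i < n) n)%N).
    by apply: leq_sum => i _; exact/ltnW/ltn_ord.
  by rewrite sum_nat_const card_ord mulnn.
(* K units of free degree, each gaining a factor B/B', pay for one unit of [E], which costs a factor
   B. *)
have [K KP] : exists K, B * (B / B') ^+ K <= 1.
  have [||| K KP] := @expr_small R (B / B') B^-1.
  - by rewrite divr_ge0 // ltW.
  - by rewrite ltr_pdivrMr // mul1r.
  - by rewrite invr_gt0.
  exists K; have := KP K (leqnn K); rewrite -(ler_pM2l B0) mulfV //.
  by rewrite gt_eqF.
(* The constant makes up for the odd positions below n1, absent from [Fr]. *)
have [n2 n2P] := cubic_dominates K (\sum_(i < n1) i ^ 2)%N n0.
have Fr_ge n : (n2 <= n)%N -> (K * E n <= Fr n)%N.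
  move=> /n2P h; rewrite -(leq_add2r (\sum_(i < n1) i ^ 2)%N); apply: leq_trans h _.
  rewrite (bigID (fun i : 'I_n => n1 <= i)%N) /=; apply: leq_add.
    rewrite [leqLHS]big_mkcond [leqRHS]big_mkcond; apply: leq_sum => i _.
    case: ifP => // /andP[/odd_free fi ->]; rewrite fi /=.
    by have [] := free_t _ fi.
  apply: leq_trans (sum_ord_lt_le (fun i => i ^ 2)%N n n1).
  rewrite [leqLHS]big_mkcond [leqRHS]big_mkcond; apply: leq_sum => i _.
  by rewrite -ltnNge andbC; case: ifP => // /andP[->].
have prod01 n : 0 <= \prod_(i < n) ((sz i)%:R^-1 : R) <= 1.
  apply/andP; split; first by apply: prodr_ge0 => i _; rewrite invr_ge0 ler0n.
  apply: (@le_trans _ _ (\prod_(i < n) 1)); last by rewrite big1.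
  by apply: ler_prod => i _; rewrite invr_ge0 ler0n /= invf_le1 ?ltr0n // ler1n.
(* The first term serves n >= n2, the sum the finitely many smaller n. *)
exists (B ^+ C0 + \sum_(i < n2) B ^+ T i).
  by rewrite ltr_pwDl ?exprn_gt0 // sumr_ge0 // => i _; rewrite exprn_ge0 // ltW.
move=> n; rewrite -/(T n) exprVn ler_pdivlMr ?exprn_gt0 //.
have [nn2|nn2] := ltnP n n2.
  apply: (@le_trans _ _ (B ^+ T n)).
    by rewrite ler_piMl ?exprn_ge0 ?(ltW B0) //; have /andP[] := prod01 n.
  rewrite (bigD1 (Ordinal nn2)) //= addrCA lerDl addr_ge0 ?exprn_ge0 ?(ltW B0) //.
  by apply: sumr_ge0 => i _; rewrite exprn_ge0 // ltW.
apply: (@le_trans _ _ (B ^+ C0)); last first.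
  by rewrite lerDl sumr_ge0 // => i _; rewrite exprn_ge0 // ltW.
apply: (@le_trans _ _ (B'^-1 ^+ Fr n * B ^+ (C0 + Fr n + E n))).
  apply: ler_pM => //; first by have /andP[] := prod01 n.
  - by rewrite exprn_ge0 // ltW.
  - by rewrite ler_weXn2l // T_le.
have -> : B'^-1 ^+ Fr n * B ^+ (C0 + Fr n + E n) = B ^+ C0 * ((B / B') ^+ Fr n * B ^+ E n).
  by rewrite !exprD exprMn; ring.
rewrite ler_piMr ?exprn_ge0 ?(ltW B0) //.
apply: (@le_trans _ _ ((B / B') ^+ (K * E n) * B ^+ E n)).
  rewrite ler_pM2r ?exprn_gt0 // ler_wiXn2l ?Fr_ge //; first by rewrite divr_ge0 // ltW.
  by rewrite ler_pdivrMr // mul1r ltW.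
by rewrite exprM -exprMn mulrC exprn_ile1 // mulr_ge0 ?exprn_ge0 ?divr_ge0 ?(ltW B0) ?(ltW B'0).
Qed.

End MassEstimate.

(** * Reserved digits, imposed digits and their positions *)

Section Design.
Variables (F : finFieldType) (S U : set {poly F}).

(* One element of [U] of degree [d], when there is one, is never reserved:
   this keeps [pdeg @` fixed_digits = pdeg @` U]. *)
Definition free_digits (d : nat) : seq {poly F} :=
  take (deg_count S d %/ d) (rem (xget 0 (deg_part U d)) (fset_set (deg_part S d))).

Definition reserved : set {poly F} := [set A | A \in free_digits (pdeg A)].

Definition fixed_digits : set {poly F} := U `\` reserved.

Lemma mem_free_digits A d : A \in free_digits d -> S A /\ pdeg A = d.
Proof. by move=> /mem_take /mem_rem /mem_deg_part. Qed.

Lemma free_digits_uniq d : uniq (free_digits d).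
Proof. by rewrite take_uniq // rem_uniq // fset_uniq. Qed.

(** For d >= 2 the share count/d is at most count - 1, so sparing one element leaves enough. *)
Lemma size_free_digits d : (1 < d)%N -> size (free_digits d) = (deg_count S d %/ d)%N.
Proof.
move=> d1; apply: size_takel.
apply: (@leq_trans (deg_count S d).-1).
  apply: leq_trans (leq_div2l _ _ d1) _; first by [].
  by rewrite divn2; lia.
have [/size_rem ->|/rem_id ->] := boolP (xget 0 (deg_part U d) \in (fset_set (deg_part S d) : seq _)).
  by [].
exact: leq_pred.
Qed.

Lemma size_free_digits_le d : (size (free_digits d) * d <= deg_count S d)%N.
Proof.
apply: leq_trans (leq_trunc_div _ d); rewrite leq_mul2r; apply/orP; right.
by rewrite size_take_min geq_minl.
Qed.

Lemma fixed_sub : fixed_digits `<=` U.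
Proof. by move=> A []. Qed.

Lemma deg_fixed_digits : @pdeg F @` fixed_digits = @pdeg F @` U.
Proof.
apply/seteqP; split => [d [A [UA _] <-]|d [A UA Ad]]; first by exists A.
have h : deg_part U d A by split.
have [Uu du] : deg_part U d (xget 0 (deg_part U d)) by apply: xgetPex; exists A.
exists (xget 0 (deg_part U d)) => //; split => //.
rewrite /reserved /= du => /mem_take.
by rewrite mem_rem_uniq ?fset_uniq // !inE eqxx.
Qed.

(** In degrees at least M at most a share 1/M of S is reserved; lower degrees contribute at most
    [ncard (QN M S)], which does not depend on N. *)
Lemma reserved_count M N : (M * ncard (QN N reserved) <=
   M * ncard (QN M S) + ncard (QN N S))%N.
Proof.
have RS : reserved `<=` S by move=> A /mem_free_digits[].
have QRS k : (ncard (QN k reserved) <= ncard (QN k S))%N.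
  by apply: ncard_le; [exact: finite_QN|move=> A [/RS]; split].
have [NM|/ltnW MN] := leqP N M.
  apply: leq_trans (leq_addr _ _); rewrite leq_mul2l; apply/orP; right.
  exact: leq_trans (card_QN_le _ NM).
have count_le d : (M <= d)%N -> (M * deg_count reserved d <= deg_count S d)%N.
  move=> Md; apply: leq_trans (size_free_digits_le d); rewrite mulnC.
  apply: leq_mul => //; apply: uniq_leq_size; first exact: fset_uniq.
  by move=> A /mem_deg_part[]; rewrite /reserved /= => h <-.
rewrite -(subnKC MN); elim: (N - M)%N => [|k IH].
  by rewrite addn0; apply: leq_trans (leq_addr _ _); rewrite leq_mul2l QRS orbT.
rewrite addnS !card_QNS mulnDr addnA; apply: leq_add => //; apply: count_le.
by rewrite leqW // leq_addr.
Qed.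

(** The 2-adic valuation gives back the degree and the odd part the code of A, whence injectivity.
    The power of 2 keeps odd positions free and makes the position at least the degree. *)
Definition fixed_position (A : {poly F}) : nat :=
  2 ^ pdeg A * (choice.pickle A).*2.+1.

Lemma fixed_position_inj : injective fixed_position.
Proof.
move=> A B; rewrite /fixed_position => e.
have odd_log k m : logn 2 (2 ^ k * m.*2.+1) = k.
  rewrite lognM ?expn_gt0 // pfactorK // logn_coprime ?addn0 //.
  by rewrite coprime2n /= odd_double.
have ed : pdeg A = pdeg B.
  by rewrite -(odd_log (pdeg A) (choice.pickle A)) e odd_log.
move: e; rewrite ed => /eqP; rewrite eqn_pmul2l ?expn_gt0 // => /eqP [/double_inj].
exact: (pcan_inj choice.pickleK).
Qed.

Lemma pdeg_fixed_position A : (pdeg A <= fixed_position A)%N.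
Proof.
apply: (@leq_trans (2 ^ pdeg A)); first exact/ltnW/ltn_expl.
by rewrite leq_pmulr.
Qed.

Lemma odd_fixed_position A : (0 < pdeg A)%N -> ~~ odd (fixed_position A).
Proof. by move=> A0; rewrite oddM oddX /= odd_double andbT orbF -lt0n. Qed.

Definition is_fixed (n : nat) : bool :=
  `[< exists2 A, fixed_digits A & fixed_position A = n >].

Definition fixed_at (n : nat) : {poly F} :=
  xget 0 [set A | fixed_digits A /\ fixed_position A = n].

Variable m : nat -> nat.

Definition digit_choices (n : nat) : seq {poly F} :=
  if is_fixed n then [:: fixed_at n] else free_digits (m n).

Definition digit_degree (n : nat) : nat :=
  if is_fixed n then pdeg (fixed_at n) else m n.

Lemma fixed_atP n : is_fixed n ->
  fixed_digits (fixed_at n) /\ fixed_position (fixed_at n) = n.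
Proof.
move=> /asboolP[A VA An].
by apply: (@xgetPex _ 0 [set B | fixed_digits B /\ fixed_position B = n]); exists A.
Qed.

Lemma digit_choices_fixed A : fixed_digits A ->
  digit_choices (fixed_position A) = [:: A].
Proof.
move=> VA; have fA : is_fixed (fixed_position A) by apply/asboolP; exists A.
rewrite /digit_choices fA; congr [:: _].
by apply: fixed_position_inj; have [] := fixed_atP fA.
Qed.

Lemma digit_choices_uniq n : uniq (digit_choices n).
Proof. by rewrite /digit_choices; case: ifP => // _; exact: free_digits_uniq. Qed.

Lemma digit_choices_degree n A : A \in digit_choices n -> pdeg A = digit_degree n.
Proof.
rewrite /digit_choices /digit_degree; case: ifP => _; first by rewrite inE => /eqP ->.
by move=> /mem_free_digits[].
Qed.

Hypothesis US : U `<=` S.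

Lemma digit_choices_sub n A : A \in digit_choices n -> S A.
Proof.
rewrite /digit_choices; case: ifP => [/fixed_atP[[UA _] _]|_].
  by rewrite inE => /eqP ->; exact: US.
by move=> /mem_free_digits[].
Qed.

(** This makes the digits of a point distinct: an imposed digit determines its position, is never
    reserved, and reserved digits at different positions have different degrees. *)
Lemma digit_choices_disjoint n n' A : injective m ->
  A \in digit_choices n -> A \in digit_choices n' -> n = n'.
Proof.
move=> m_inj; rewrite /digit_choices.
have [/fixed_atP[V1 e1]|_] := boolP (is_fixed n); have [/fixed_atP[V2 e2]|_] := boolP (is_fixed n').
- by rewrite !inE => /eqP e3 /eqP e4; rewrite -e1 -e2 -e3 e4.
- rewrite inE => /eqP -> /[dup] /mem_free_digits [_ dA] h.
  by exfalso; case: V1 => _; apply; rewrite /reserved /= dA.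
- move=> /[dup] /mem_free_digits [_ dA] h; rewrite inE => /eqP e.
  by exfalso; case: V2 => _; apply; rewrite /reserved /= -e dA.
- by move=> /mem_free_digits [_ d1] /mem_free_digits [_ d2]; apply: m_inj; rewrite -d1 -d2.
Qed.

Hypothesis S1 : S `<=` @poly1 F.

Lemma fixed_pdeg_gt0 n : is_fixed n -> (0 < pdeg (fixed_at n))%N.
Proof. by move=> /fixed_atP[[/US /S1]]. Qed.

Lemma is_fixed_even n : odd n -> ~~ is_fixed n.
Proof.
apply: contraL => h; have := odd_fixed_position (fixed_pdeg_gt0 h).
by have [_ ->] := fixed_atP h.
Qed.

Lemma digit_degree_fixed n : is_fixed n -> (digit_degree n <= n)%N.
Proof.
move=> h; rewrite /digit_degree h; have [_ e] := fixed_atP h.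
by rewrite -[leqRHS]e; exact: pdeg_fixed_position.
Qed.

End Design.

(** * Upper densities are unaffected by the reserved set *)

Section UpperDensity.
Variable R : realType.

Lemma limn_esup_le (u v : (\bar R)^nat) :
  (forall e : R, 0 < e -> \forall n \near \oo, (u n <= v n + e%:E)%E) ->
  (limn_esup u <= limn_esup v)%E.
Proof.
move=> uv; apply/lee_addgt0Pr => e e0; rewrite -leeBlDr //.
apply: le_ereal_inf_tmp => _ [V Voo <-]; rewrite leeBlDr //.
apply: (@le_trans _ _ (ereal_sup (u @` (V `&` [set n | (u n <= v n + e%:E)%E])))).
  apply: ereal_inf_lbound; eexists; last by reflexivity.
  by apply: filterI => //; exact: uv.
apply: ge_ereal_sup => _ [n [Vn un] <-]; apply: le_trans un _.
by rewrite leeD2r //; apply: ereal_sup_ubound; exists n.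
Qed.

Lemma limn_esup_eq (u v : (\bar R)^nat) : (forall n, (v n <= u n)%E) ->
  (forall e : R, 0 < e -> \forall n \near \oo, (u n <= v n + e%:E)%E) ->
  limn_esup u = limn_esup v.
Proof.
move=> vu uv; apply/eqP; rewrite eq_le !limn_esup_le // => e e0.
by apply: nearW => n; apply: le_trans (vu n) _; rewrite leeDl // lee_fin ltW.
Qed.

Variable F : finFieldType.

(** X will be the part of U consisting of the digits common to all points of the Cantor set, or of
    the digits of a single point. *)
Lemma upper_density_reserved (S U X : set {poly F}) : U `<=` S ->
  (forall n, exists N, (n <= ncard (QN N S))%N) ->
  fixed_digits S U `<=` X -> X `<=` U ->
  upper_density_poly R X S = upper_density_poly R U S.
Proof.
move=> US Sinf VX XU; apply/esym/limn_esup_eq => [N|e e0].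
  rewrite lee_fin ler_wpM2r ?invr_ge0 ?ler0n // ler_nat.
  by apply: ncard_le; [exact: finite_QN|move=> A [/XU]; split].
(* With M > 2/e, and N so large that S has more than 2 [ncard (QN M S)]/e elements up to degree N,
   each term of [reserved_count], divided by M, is at most half of e times that number. *)
pose M := Num.bound (2 / e).
have M_gt : 2 / e < M%:R by apply: archi_boundP; rewrite divr_ge0 // ltW.
have M0 : 0 < M%:R :> R by apply: le_lt_trans M_gt; rewrite divr_ge0 // ltW.
pose k := Num.bound (2 * (ncard (QN M S))%:R / e).
have k_gt : 2 * (ncard (QN M S))%:R / e < k%:R.
  by apply: archi_boundP; rewrite divr_ge0 ?mulr_ge0 // ltW.
have [N0 N0P] := Sinf k.+1; exists N0 => // N /= N0N.
have QS : (k < ncard (QN N S))%N by apply: leq_trans N0P _; exact: card_QN_le.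
have QS0 : 0 < (ncard (QN N S))%:R :> R by rewrite ltr0n (leq_ltn_trans _ QS).
rewrite -EFinD lee_fin -[e in leRHS](mulfK (lt0r_neq0 QS0)) -mulrDl ler_pM2r ?invr_gt0 //.
have split_card : (ncard (QN N U) <= ncard (QN N X) + ncard (QN N (reserved S U)))%N.
  apply: (@leq_trans (ncard (QN N X `|` QN N (reserved S U)))).
    apply: ncard_le; first by rewrite finite_setU; split; exact: finite_QN.
    move=> A [UA AN]; have [RA|RA] := pselect (reserved S U A); first by right.
    by left; split => //; apply: VX; split.
  rewrite /ncard fset_setU; [|exact: finite_QN|exact: finite_QN].
  by rewrite cardfsU leq_subr.
have res := reserved_count S U M N.
rewrite -(ler_nat R) natrD !natrM in res.
rewrite -(ler_nat R) natrD in split_card.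
rewrite -(ltr_nat R) in QS.
rewrite ltr_pdivrMr // in k_gt; rewrite ltr_pdivrMr // in M_gt.
move: k_gt M_gt QS split_card res.
move: (ncard (QN N U))%:R (ncard (QN N X))%:R (ncard (QN N (reserved S U)))%:R.
move: (ncard (QN N S))%:R (ncard (QN M S))%:R QS0 k%:R M%:R M0.
move=> s s' s0 kk mm mm0 u x r h1 h2 h3 h4 h5.
have r_le : r <= e * s.
  rewrite -(ler_pM2l mm0); apply: le_trans h5 _.
  have p1 : 0 <= mm * (kk * e - 2 * s') by apply: mulr_ge0; lra.
  have p2 : 0 <= mm * e * (s - kk) by apply: mulr_ge0; [apply: mulr_ge0|]; lra.
  have p3 : 0 <= s * (mm * e - 2) by apply: mulr_ge0; lra.
  lra.
lra.
Qed.

End UpperDensity.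

(** * Choice of degrees and the two dimension bounds *)

Section MainConstruction.
Variables (R : realType) (F : finFieldType).
Local Notation q := (#|F|%:R : R).
Local Notation qi := (q^-1).

(** Lowering the base from a to B absorbs the factor m^c and the division by m: otherwise k <= 2 m
    B^m, and a^m <= 2 m^(c+1) B^m <= a^m / 2. *)
Lemma divn_growth (a B : R) (c : nat) : 1 <= B -> B < a ->
  exists M, forall m k, (M <= m)%N -> (0 < m)%N ->
    a ^+ m <= m%:R ^+ c * k%:R -> B ^+ m <= (k %/ m)%:R.
Proof.
move=> B1 Ba; have B0 : 0 < B := lt_le_trans ltr01 B1.
have a0 : 0 < a := lt_trans B0 Ba.
have [|||M MP] := @natX_expr_small R (B / a) (4^-1) c.+1.
- by rewrite divr_ge0 // ltW.
- by rewrite ltr_pdivrMr // mul1r.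
- by rewrite invr_gt0.
exists M => m k Mm m0 h; rewrite leNgt; apply/negP => small.
have Bm1 : 1 <= B ^+ m by rewrite exprn_ege1.
have k_lt : k%:R <= 2 * B ^+ m * m%:R.
  apply: (@le_trans _ _ ((k %/ m).+1 * m)%:R).
    by rewrite ler_nat ltnW // ltn_ceil.
  by rewrite natrM ler_pM2r ?ltr0n // -natr1; lra.
have mc0 : 0 <= m%:R ^+ c :> R by rewrite exprn_ge0 // ler0n.
have am0 : 0 < a ^+ m by rewrite exprn_gt0.
have := MP m Mm; rewrite exprMn exprVn mulrA ler_pdivrMr //.
have := le_trans h (ler_wpM2l mc0 k_lt).
have -> : m%:R ^+ c * (2 * B ^+ m * m%:R) = 2 * (m%:R ^+ c.+1 * B ^+ m) :> R.
  by rewrite exprSr; ring.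
by move: (_ * B ^+ m) (a ^+ m) am0 => x y y0 h1 h2; lra.
Qed.

Lemma degree_sequence (S U : set {poly F}) (a g1 g2 : R) (b N0 : nat) :
  1 < a -> 0 < g1 -> 0 < g2 ->
  (forall N, (N0 <= N)%N ->
      g1 * a ^+ N <= N%:R ^+ b * (ncard (QN N S))%:R /\
      (ncard (QN N S))%:R <= g2 * a ^+ N) ->
  exists n0 (m : nat -> nat), forall n,
    [/\ ((n + n0) ^ 2 < m n)%N, (m n <= (n + n0).+1 ^ 2)%N, (1 < m n)%N,
        a ^+ m n <= (m n)%:R ^+ b.+1 * (deg_count S (m n))%:R
      & (0 < size (free_digits S U (m n)))%N].
Proof.
move=> a1 g10 g20 H.
have [n1 P1] := deg_window a1 g10 g20 H.
(* The base 1 is enough for the reserved lists to be nonempty. *)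
have [M P2] := divn_growth b.+1 (lexx 1) a1.
pose n0 := maxn n1 (maxn M 2); exists n0.
have /choice [m mP] : forall n, exists k, [/\ ((n + n0) ^ 2 < k)%N, (k <= (n + n0).+1 ^ 2)%N &
   a ^+ k <= k%:R ^+ b.+1 * (deg_count S k)%:R].
  by move=> n; apply: P1; apply: leq_trans (leq_addl _ _); exact: leq_maxl.
exists m => n; have [h1 h2 h3] := mP n.
have n0_le : (n0 <= m n)%N.
  apply: leq_trans (ltnW h1); apply: (@leq_trans (n + n0)); first exact: leq_addl.
  by rewrite -mulnn; case: (n + n0)%N => // k; rewrite leq_pmull.
have m1 : (1 < m n)%N by apply: leq_trans n0_le; rewrite /n0 !leq_max leqnn !orbT.
split => //; rewrite size_free_digits //.
have := P2 (m n) _ _ (ltnW m1) h3; rewrite expr1n ler1n; apply.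
by apply: leq_trans n0_le; rewrite /n0 !leq_max leqnn /= orbT.
Qed.

Lemma cantor_dim_ge (S U : set {poly F}) (alpha : R) (n0 c : nat) (m : nat -> nat) :
  0 < alpha -> S `<=` @poly1 F -> U `<=` S ->
  (forall n, [/\ ((n + n0) ^ 2 < m n)%N, (m n <= (n + n0).+1 ^ 2)%N, (1 < m n)%N,
     (q `^ alpha^-1) ^+ m n <= (m n)%:R ^+ c * (deg_count S (m n))%:R
   & (0 < size (free_digits S U (m n)))%N]) ->
  (((2 * alpha)^-1)%:E <=
    hausdorff_dim (@ldist R F) (cf_cantor (digit_choices S U m)))%E.
Proof.
move=> al0 S1 US mP; apply: hausdorff_dim_lb => s /andP[s0 s_lt].
pose a := q `^ alpha^-1; pose B := q `^ (2 * s).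
have Ba : B < a := weight_gt1 F al0 s_lt.
have B1 : 1 <= B.
  by rewrite -[leLHS](powRr0 q) ltW // ltr_powR_exponent // mulr_gt0.
(* B^(-T) is the s-th power of the scale q^(-2T); the gap between B and B' serves the mass estimate,
   the gap between B' and a the passage to reserved digits. *)
pose B' := (B + a) / 2.
have BB' : B < B' by rewrite /B'; lra.
have B'a : B' < a by rewrite /B'; lra.
have [M MP] := divn_growth c (le_trans B1 (ltW BB')) B'a.
pose D := digit_choices S U m; pose t := digit_degree S U m.
have sz0 n : (0 < size (D n))%N.
  by rewrite /D /digit_choices; case: ifP => // _; have [] := mP n.
have [||n fn|n fn|n nM fn|C C0 CP] :=
    @mass_estimate R (fun n => size (D n)) t (fun n => ~~ is_fixed S U n) B B' n0 M B1 BB'.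
- exact: sz0.
- by move=> n on; exact: (is_fixed_even US S1 on).
- rewrite /t /digit_degree (negPf fn); have [h1 h2 _ _ _] := mP n; split => //.
  by apply: leq_trans (ltnW h1); rewrite leq_exp2r // leq_addr.
- by rewrite negbK in fn; exact: (digit_degree_fixed _ fn).
- rewrite /D /digit_choices /t /digit_degree (negPf fn).
  have [h1 _ h2 h3 _] := mP n; rewrite size_free_digits //; apply: MP h3; last exact: ltnW.
  apply: leq_trans nM (leq_trans _ (ltnW h1)).
  by apply: (@leq_trans (n + n0)); rewrite ?leq_addr // -mulnn; case: (n + n0)%N => // k; rewrite leq_pmull.
apply: (@cantor_measure_neq0 R F D t s C) => //.
- exact: digit_choices_uniq.
- by move=> k; rewrite -size_eq0 -lt0n.
- move=> k; rewrite /t /digit_degree; case: ifP => [/(fixed_pdeg_gt0 US S1)//|_].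
  by have [_ _ h _ _] := mP k; exact: ltnW.
- by move=> k A; exact: digit_choices_degree.
move=> n; have -> : (qi ^+ (2 * \sum_(i < n.+1) t i)) `^ s = B^-1 ^+ (\sum_(i < n.+1) t i)%N.
  by rewrite powR_exprn ?(ltW (qi_gt0 R F)) // exprM qi_powR_sqr.
exact: CP.
Qed.

Lemma distinct_digits_dim_le (S : set {poly F}) (alpha g : R) (N0 : nat) :
  0 < alpha -> S `<=` @poly1 F -> 0 < g ->
  (forall N, (N0 <= N)%N -> (ncard (QN N S))%:R <= g * (q `^ alpha^-1) ^+ N) ->
  (hausdorff_dim (@ldist R F) (distinct_digits_in R S) <= ((2 * alpha)^-1)%:E)%E.
Proof.
move=> al0 S1 g0 H; have al'0 : 0 < (2 * alpha)^-1 by rewrite invr_gt0 mulr_gt0.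
apply: hausdorff_dim_ub => // s s_gt; have s0 := lt_trans al'0 s_gt.
have /andP[_ w1] := weight_lt1 F al0 s_gt.
have [|M MP] := @tail_weight R F S _ g _ N0 (powR_ge0 _ _) _ w1 g0 H.
  by rewrite exprn_ge0 // powR_ge0.
apply: (@measure_distinct_digits_eq0 R F S s M) => // X uX XS.
rewrite (eq_bigr (fun A => ((qi `^ s) ^+ 2) ^+ pdeg A)); first exact: MP.
by move=> A _; rewrite powR_exprn ?(ltW (qi_gt0 R F)) // exprM.
Qed.

End MainConstruction.

Theorem mainTheorem1 (R : realType) (F : finFieldType) (alpha : R)
    (S U : set {poly F}) :
  S `<=` @poly1 F -> infinite_set S -> growth_density S alpha ->
  U `<=` S -> (0 < upper_density_poly R U S)%E ->
  (exists ESU : set (laurent F),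
    [/\ ESU `<=` distinct_digits_in R S,
        hausdorff_dim (@ldist R F) ESU
          = hausdorff_dim (@ldist R F) (distinct_digits_in R S) /\
        hausdorff_dim (@ldist R F) (distinct_digits_in R S)
          = (1 / (2 * alpha))%:E,
        upper_density_poly R
          ((\bigcup_(n in posn) \bigcap_(x in ESU) [set digit n x]) `&` U) S
          = upper_density_poly R U S
      & upper_density_nat R
          ((\bigcup_(n in posn) \bigcap_(x in ESU) [set pdeg (digit n x)])
             `&` (@pdeg F @` U))
          (@pdeg F @` S)
          = upper_density_nat R (@pdeg F @` U) (@pdeg F @` S)]) /\
  hausdorff_dim (@ldist R F)
    [set x | [/\ distinct_digits R x,
        digits x `<=` S,
        upper_density_poly R (digits x `&` U) S = upper_density_poly R U S
      & upper_density_nat R ((@pdeg F @` digits x) `&` (@pdeg F @` U))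
          (@pdeg F @` S)
          = upper_density_nat R (@pdeg F @` U) (@pdeg F @` S)]]
  = hausdorff_dim (@ldist R F) (distinct_digits_in R S).
Proof.
move=> S1 _ growth US _.
have al0 : 0 < alpha by have [h _] := growth; exact: lt_le_trans h.
have [g1 [g2 [b [N0 [g10 g20 H]]]]] := growth_bounds growth.
have [n0 [m mP]] := degree_sequence U (growth_rate_gt1 F al0) g10 g20 H.
pose E := cf_cantor (digit_choices S U m).
(* Consecutive windows are disjoint, so the degrees m n increase strictly. *)
have m_mono n : (m n < m n.+1)%N.
  have [_ h _ _ _] := mP n; have [h' _ _ _ _] := mP n.+1.
  by apply: leq_ltn_trans h h'.
have m_inj : injective m.
  have mono : {homo m : i j / (i < j)%N} by apply: (homo_ltn ltn_trans m_mono).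
  by move=> i j e; case: (ltngtP i j) => // /mono; rewrite e ltnn.
have ES : E `<=` distinct_digits_in R S.
  move=> x [x1 xr xD]; split.
    split => //; first exact/DeltaP.
    move=> [//|i] [//|j] _ _ ij e; apply: ij; congr _.+1.
    by apply: (digit_choices_disjoint m_inj (xD i)); rewrite e.
  by move=> _ [[//|i] _ <-]; exact: (digit_choices_sub US (xD i)).
have dim_ge := cantor_dim_ge al0 S1 US mP.
have dim_le := distinct_digits_dim_le al0 S1 g20 (fun N h => (H N h).2).
have dim_S : hausdorff_dim (@ldist R F) (distinct_digits_in R S) = ((2 * alpha)^-1)%:E.
  by apply/eqP; rewrite eq_le dim_le (le_trans dim_ge) // hausdorff_dim_le.
(* Applied to the Cantor set itself and to the set of the last assertion. *)
have dim_between X : E `<=` X -> X `<=` distinct_digits_in R S ->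
    hausdorff_dim (@ldist R F) X = hausdorff_dim (@ldist R F) (distinct_digits_in R S).
  move=> EX XS; apply/eqP; rewrite eq_le hausdorff_dim_le //= dim_S.
  by apply: le_trans dim_ge _; exact: hausdorff_dim_le.
(* A nonempty reserved list in degree m n forces at least m n >= n elements of that degree in S. *)
have Sinf n : exists N, (n <= ncard (QN N S))%N.
  exists (m n); apply: leq_trans (deg_count_le_QN _ _).
  have [h _ h2 _ h3] := mP n; apply: leq_trans (size_free_digits_le S U _).
  rewrite -[leqLHS]mul1n; apply: leq_mul => //; apply: leq_trans (ltnW h).
  by apply: (@leq_trans (n + n0)); rewrite ?leq_addr // -mulnn; case: (n + n0)%N => // k; rewrite leq_pmull.
have fixedE x A : E x -> fixed_digits S U A -> digit (fixed_position A).+1 x = A.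
  move=> [_ _ xD] /(digit_choices_fixed m) DA.
  by have := xD (fixed_position A); rewrite DA inE => /eqP.
split.
  exists E; split => //.
  - split; first exact: dim_between.
    by rewrite dim_S div1r.
  - apply: upper_density_reserved => // A VA; split; last exact: fixed_sub VA.
    by exists (fixed_position A).+1 => // x Ex /=; rewrite (fixedE x).
  (* The two degree sets coincide, since every degree of U is the degree of an imposed digit. *)
  congr (upper_density_nat R _ _); apply/seteqP; split => [d []//|d Ud]; split => //.
  move: Ud; rewrite -(deg_fixed_digits S) => -[A VA <-].
  by exists (fixed_position A).+1 => // x Ex /=; rewrite (fixedE x).
apply: dim_between => [x Ex|x [xd xS _ _]]; last by split.
have [xd xS] := ES x Ex; split => //.
  apply: upper_density_reserved => // A VA; split; last exact: fixed_sub VA.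
  by exists (fixed_position A).+1 => //; rewrite (fixedE x).
congr (upper_density_nat R _ _); apply/seteqP; split => [d []//|d Ud]; split => //.
move: Ud; rewrite -(deg_fixed_digits S) => -[A VA <-]; exists A => //.
by exists (fixed_position A).+1 => //; rewrite (fixedE x).
Qed.
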